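(* There exists an absolute constant $c>0$ (not depending on $n,\sigma,k$) such that the following holds. Let $n\ge 2$, $\sigma>0$, let $k$ be an integer with $1\le k\le n$, and for $\boldsymbol\mu\in\mathbb{R}^n$ let $\mathbf{y}=\boldsymbol\mu+\boldsymbol\xi$ where $\boldsymbol\xi$ has distribution $\mathcal{N}(0,\sigma^2 I_{n\times n})$. Let $\hat{\boldsymbol\mu}^{Q}$ be the estimator defined in the context. Then $$\sup_{\boldsymbol\mu\in\mathbb{R}^n}\left(\mathbb{E}_{\boldsymbol\mu}\|\hat{\boldsymbol\mu}^{Q}-\boldsymbol\mu\|-\min_{\boldsymbol u\in\mathcal{S}^\uparrow_k}\|\boldsymbol u-\boldsymbol\mu\|\right)\le c\sqrt{\frac{\sigma^2k}{n}\log\left(\frac{en}{k}\right)},$$ $$\sup_{\boldsymbol\mu\in\mathbb{R}^n}\left(\mathbb{E}_{\boldsymbol\mu}\|\hat{\boldsymbol\mu}^{Q}-\boldsymbol\mu\|^2-\min_{\boldsymbol u\in\mathcal{S}^\uparrow_k}\|\boldsymbol u-\boldsymbol\mu\|^2\right)\le \frac{c\,\sigma^2k}{n}\log\left(\frac{en}{k}\right).$$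
   Context: Norm: $\|\boldsymbol u\|^2=\frac1n\sum_{i=1}^n u_i^2$ for $\boldsymbol u\in\mathbb{R}^n$ (scaled Euclidean norm). $\mathbb{E}_{\boldsymbol\mu}$ is the expectation with respect to the distribution of $\mathbf{y}=\boldsymbol\mu+\boldsymbol\xi$. $\mathcal{S}^\uparrow=\{\boldsymbol u\in\mathbb{R}^n: u_i\le u_{i+1},\ i=1,\dots,n-1\}$. For $\boldsymbol u\in\mathbb{R}^n$, $k(\boldsymbol u)\ge1$ is the integer such that $k(\boldsymbol u)-1$ is the cardinality of $\{i\in\{1,\dots,n-1\}: u_{i+1}\ne u_i\}$, and $\mathcal{S}^\uparrow_k=\{\boldsymbol u\in\mathcal{S}^\uparrow: k(\boldsymbol u)\le k\}$. Estimator $\hat{\boldsymbol\mu}^{Q}$ (a function of $\mathbf{y}$, with $\sigma$ known): for every $J\subseteq\{1,\dots,n-1\}$ (including $J=\emptyset$) let $$\pi_J=\frac{\exp(-|J|)}{H\binom{n-1}{|J|}},\qquad H=\sum_{i=0}^{n-1}\exp(-i),$$ let $V_J=\{\boldsymbol u\in\mathbb{R}^n:\ u_{i+1}=u_i\ \text{for all } i\in\{1,\dots,n-1\}\setminus J\}$, and let $P_J\in\mathbb{R}^{n\times n}$ be the orthogonal projector onto $V_J$. For $\boldsymbol\theta=(\theta_J)_{J\subseteq\{1,\dots,n-1\}}$ with real entries put $\boldsymbol\mu_{\boldsymbol\theta}=\sum_{J}\theta_J P_J\mathbf{y}$. Let $\Lambda=\{\boldsymbol\theta:\ \theta_J\ge0\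 \text{for all }J,\ \sum_J\theta_J=1\}$. Then $\hat{\boldsymbol\mu}^{Q}=\boldsymbol\mu_{\hat{\boldsymbol\theta}}$, where $\hat{\boldsymbol\theta}$ is a minimizer over $\boldsymbol\theta\in\Lambda$ of $$\|\boldsymbol\mu_{\boldsymbol\theta}-\mathbf{y}\|^2+\sum_{J\subseteq\{1,\dots,n-1\}}\theta_J\left(\frac{2\sigma^2|J|}{n}+\frac12\|\boldsymbol\mu_{\boldsymbol\theta}-P_J\mathbf{y}\|^2+\frac{46\sigma^2}{n}\log\frac1{\pi_J}\right).$$ *)

(* Defs.v *)
From HB Require Import structures.
From mathcomp Require Import all_boot all_order all_algebra.
From mathcomp Require Import all_classical all_reals all_analysis.

Set Implicit Arguments.
Unset Strict Implicit.
Unset Printing Implicit Defensive.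
Import Order.TTheory GRing.Theory Num.Theory.
Import numFieldNormedType.Exports.

Local Open Scope classical_set_scope.
Local Open Scope ring_scope.

(* The gap between the (0-based) coordinates i and i.+1 of a vector of R^n is
   indexed by i : 'I_n.-1; subsets J of {1, ..., n-1} are {set 'I_n.-1}. *)
Definition gapl n (i : 'I_n.-1) : 'I_n := widen_ord (leq_pred n) i.

Definition gapr n (i : 'I_n.-1) : 'I_n :=
  Ordinal (etrans (esym (ltn_predRL i n)) (ltn_ord i)).

Section Vectors.
Context {R : realType} {n : nat}.
Implicit Types (u v x y : 'cV[R]_n) (J : {set 'I_n.-1}).

Definition snorm u : R := Num.sqrt (n%:R^-1 * \sum_(i < n) u i 0 ^+ 2).

Definition mono : set 'cV[R]_n :=
  [set u | forall i : 'I_n.-1, u (gapl i) 0 <= u (gapr i) 0].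

Definition npieces u : nat :=
  #|[set i : 'I_n.-1 | u (gapr i) 0 != u (gapl i) 0]%SET|.+1.

Definition monok (k : nat) : set 'cV[R]_n :=
  mono `&` [set u | (npieces u <= k)%N].

Definition VJ J : set 'cV[R]_n :=
  [set u | forall i : 'I_n.-1, i \notin J -> u (gapr i) 0 = u (gapl i) 0].

Definition orthogonal_projector (V : set 'cV[R]_n) (P : 'M[R]_n) : Prop :=
  forall x, V (P *m x) /\ forall v, V v -> v^T *m (x - P *m x) = 0.

Lemma tr_mul_eq0 v : v^T *m v = 0 -> v = 0.
Proof.
move=> /matrixP/(_ 0 0); rewrite !mxE => /eqP.
under eq_bigr do rewrite mxE -expr2.
rewrite psumr_eq0 => [|i _]; last exact: sqr_ge0.
move=> /allP v0; apply/matrixP => i j; rewrite ord1 mxE.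
by have := v0 i (mem_index_enum _); rewrite sqrf_eq0 => /eqP.
Qed.

Lemma orthogonal_projector_exists J :
  exists P, orthogonal_projector (VJ J) P.
Proof.
pose D : 'M[R]_(n.-1, n) := \matrix_(i, j)
  ((i \notin J)%:R * ((j == gapr i)%:R - (j == gapl i)%:R)).
have DE u i : (D *m u) i 0 = (i \notin J)%:R * (u (gapr i) 0 - u (gapl i) 0).
  rewrite mxE; under eq_bigr do rewrite mxE -mulrA mulrBl.
  have sel (l : 'I_n) : \sum_j (j == l)%:R * u j 0 = u l 0.
    rewrite (bigD1 l) //= eqxx mul1r big1 ?addr0 // => j /negPf ->.
    by rewrite mul0r.
  by rewrite -mulr_sumr sumrB !sel.
have VE u : VJ J u <-> D *m u = 0.
  split=> [uV|Du0 i iJ].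
    apply/matrixP => i j; rewrite ord1 DE mxE.
    by case: (boolP (i \in J)) => [|/uV ->]; rewrite ?mul0r // subrr mulr0.
  have := DE u i; rewrite Du0 mxE iJ mul1r => /esym/eqP.
  by rewrite subr_eq0 => /eqP.
pose K := kermx D^T; pose L := kermx K^T.
have KL0 : (K :&: L = 0)%MS.
  apply/eqP/rowV0P => v; rewrite sub_capmx => /andP[vK /sub_kermxP vL].
  have /submxP[a vE] := vK.
  have := @tr_mul_eq0 v^T; rewrite trmxK {2}vE trmx_mul mulmxA vL mul0mx.
  by move=> /(_ erefl) /(congr1 trmx); rewrite trmxK trmx0.
have KLfull : row_full (K + L)%MS.
  rewrite /row_full mxrank_disjoint_sum // [\rank L]mxrank_ker mxrank_tr.
  by rewrite subnKC // rank_leq_col.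
exists (proj_mx K L)^T => x; split=> [|v /VE Dv0].
  apply/VE; apply: trmx_inj; rewrite trmx0 2!trmx_mul trmxK.
  by apply/sub_kermxP; exact: proj_mx_sub.
have vK : (v^T <= K)%MS by apply/sub_kermxP; rewrite -trmx_mul Dv0 trmx0.
have /submxP[a vE] := vK.
have xL : (x^T - x^T *m proj_mx K L <= L)%MS.
  by apply: proj_mx_compl_sub; exact: submx_full.
apply: trmx_inj; rewrite trmx_mul trmxK trmx0 linearB /= trmx_mul trmxK.
have -> : v = K^T *m a^T by rewrite -trmx_mul -vE trmxK.
by rewrite mulmxA (sub_kermxP xL) mul0mx.
Qed.

Lemma orthogonal_projector_unique J P Q :
  orthogonal_projector (VJ J) P -> orthogonal_projector (VJ J) Q -> P = Q.
Proof.
move=> hP hQ; suff PQ x : P *m x = Q *m x.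
  by apply/matrixP=> i j; have /matrixP/(_ i 0) := PQ (delta_mx j 0);
    rewrite -!colE !mxE.
have [PV Pperp] := hP x; have [QV Qperp] := hQ x.
have dV : VJ J (P *m x - Q *m x).
  by move=> i iJ; move: (PV i iJ) (QV i iJ); rewrite !mxE => -> ->.
apply/eqP; rewrite -subr_eq0; apply/eqP/tr_mul_eq0.
have wE : P *m x - Q *m x = (x - Q *m x) - (x - P *m x).
  by rewrite opprB [RHS]addrC addrA subrK.
by rewrite {2}wE mulmxBr Qperp // Pperp // subrr.
Qed.

Definition PJ J : 'M[R]_n := xget 0 [set P | orthogonal_projector (VJ J) P].

Lemma PJ_projector J : orthogonal_projector (VJ J) (PJ J).
Proof.
by have [P hP] := orthogonal_projector_exists J; exact: (xgetI _ hP).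
Qed.

Definition Hsum : R := \sum_(i < n) expR (- i%:R).

Definition prior J : R :=
  expR (- #|J|%:R) / (Hsum * ('C(n.-1, #|J|))%:R).

Definition simplex : set ({set 'I_n.-1} -> R) :=
  [set theta | (forall J, 0 <= theta J) /\ \sum_J theta J = 1].

Definition mu_of (theta : {set 'I_n.-1} -> R) y : 'cV[R]_n :=
  \sum_J theta J *: (PJ J *m y).

Definition Qcrit (sigma : R) y (theta : {set 'I_n.-1} -> R) : R :=
  snorm (mu_of theta y - y) ^+ 2 +
  \sum_J theta J *
    (2 * sigma ^+ 2 * #|J|%:R / n%:R
     + 2^-1 * snorm (mu_of theta y - PJ J *m y) ^+ 2
     + 46 * sigma ^+ 2 / n%:R * ln (1 / prior J)).

(* Minimizing weights need not be unique, but mu_of theta y is the same for all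
   of them: on the simplex the criterion equals an affine function of theta
   plus snorm (mu_of theta y) ^+ 2 / 2. *)
Definition is_Q_weights (sigma : R) y (theta : {set 'I_n.-1} -> R) : Prop :=
  simplex theta /\
  forall theta', simplex theta' -> Qcrit sigma y theta <= Qcrit sigma y theta'.

End Vectors.

Section MonotoneMinimum.
Context {R : realType} {n : nat}.

Let coordT_continuous (i : 'I_n) : continuous (fun v : 'rV[R]_n => v^T i 0).
Proof.
have -> : (fun v : 'rV[R]_n => v^T i 0) = (fun v => v 0 i).
  by apply/funext => v; rewrite mxE.
exact: coord_continuous.
Qed.

Let closed_coordT (i j : 'I_n) (F : R -> Prop) :
  closed [set x : R | F x] ->
  closed [set v : 'rV[R]_n | F (v^T i 0 - v^T j 0)].
Proof.
move=> Fcl; apply: (@preimage_closed _ _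
  (fun v : 'rV[R]_n => v^T i 0 - v^T j 0) _ _ Fcl) => v _.
by apply: continuousB; exact: coordT_continuous.
Qed.

Let monokE k : monok k = \bigcup_(J in [set J : {set 'I_n.-1} | (#|J| < k)%N])
  (mono `&` VJ J) :> set 'cV[R]_n.
Proof.
apply/seteqP; split=> [u [um uk]|u [J /= Jk [um uJ]]].
  exists [set i : 'I_n.-1 | u (gapr i) 0 != u (gapl i) 0]%SET => //.
  by split=> // i; rewrite inE negbK => /eqP.
split=> //=; apply: leq_trans Jk; rewrite ltnS subset_leq_card //.
by apply/fintype.subsetP => i; rewrite inE; apply: contraR => /uJ ->.
Qed.

Let closed_monok k : closed [set v : 'rV[R]_n | monok k v^T].
Proof.
rewrite monokE [X in closed X](_ : _ =
  \bigcup_(J in [set J : {set 'I_n.-1} | (#|J| < k)%N])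
    ([set v : 'rV[R]_n | mono v^T] `&` [set v : 'rV[R]_n | VJ J v^T])); last first.
  by apply/seteqP; split=> v [J Jk vJ]; exists J.
apply: closed_bigcup => [|J _]; first exact: finite_finset.
apply: closedI.
  rewrite [X in closed X](_ : _ = \bigcap_(i in [set: 'I_n.-1])
    [set v : 'rV[R]_n | 0 <= v^T (gapr i) 0 - v^T (gapl i) 0]); last first.
    apply/seteqP; split=> v h i; first by move=> _ /=; rewrite subr_ge0 h.
    by have := h i Logic.I; rewrite /= subr_ge0.
  apply: closed_bigI => i _; apply: (@closed_coordT _ _ (fun x => 0 <= x)).
  exact: closed_ge.
rewrite [X in closed X](_ : _ = \bigcap_(i in [set i | i \notin J])
  [set v : 'rV[R]_n | v^T (gapr i) 0 - v^T (gapl i) 0 = 0]); last first.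
  apply/seteqP; split=> v h i iJ; first by rewrite /= h // subrr.
  by apply/eqP; rewrite -subr_eq0; apply/eqP; exact: h.
apply: closed_bigI => i _; apply: (@closed_coordT _ _ (fun x => x = 0)).
exact: closed_eq.
Qed.

Lemma monok_min_attained k (mu : 'cV[R]_n) : (1 <= k)%N ->
  exists2 u, monok k u & forall v, monok k v -> snorm (u - mu) <= snorm (v - mu).
Proof.
move=> k1; pose S (v : 'rV[R]_n) := \sum_i (v^T i 0 - mu i 0) ^+ 2.
have S_cont : continuous S.
  apply: continuous_big => [|i _]; first exact: add_continuous.
  move=> v; apply: (@continuous_comp _ _ _ (fun v : 'rV[R]_n => v^T i 0 - mu i 0)
    (fun x => x ^+ 2)); last exact: exprn_continuous.
  apply: continuousB; first exact: coordT_continuous.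
  exact: cst_continuous.
have snormS v : snorm (v - mu) = Num.sqrt (n%:R^-1 * S v^T).
  congr (Num.sqrt (_ * _)); apply: eq_bigr => i _.
  by rewrite trmxK !mxE.
have S_le v w : S v^T <= S w^T -> snorm (v - mu) <= snorm (w - mu).
  by move=> vw; rewrite !snormS ler_wsqrtr // ler_wpM2l // invr_ge0.
pose A := [set v : 'rV[R]_n | monok k v^T] `&` [set v | S v <= S 0].
have A0 : A 0.
  split=> //=; rewrite trmx0; split=> [i|/=]; first by rewrite !mxE.
  rewrite /npieces (_ : [set _ | _]%SET = finset.set0) ?cards0 //.
  by apply/setP => i; rewrite !inE !mxE eqxx.
have Acl : closed A.
  apply: closedI; first exact: closed_monok.
  apply: (@preimage_closed _ _ S [set x | x <= S 0]); last exact: closed_le.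
  by move=> v _; exact: S_cont.
have Abd : bounded_set A.
  exists (\sum_i `|mu i 0| + Num.sqrt (S 0)); split; first exact: num_real.
  move=> M MA v [_ vS]; apply: ltW; apply: le_lt_trans MA.
  rewrite [`|v|]mx_normrE; apply/bigmax_leP; split=> [|[a i] _ /=].
    by rewrite addr_ge0 ?sumr_ge0 ?sqrtr_ge0.
  rewrite ord1 -[v 0 i](subrK (mu i 0)) addrC (le_trans (ler_normD _ _))//.
  apply: lerD; first by rewrite (bigD1 i) //= lerDl sumr_ge0.
  rewrite -sqrtr_sqr ler_wsqrtr //; apply: le_trans vS.
  by rewrite /S (bigD1 i) //= mxE lerDl sumr_ge0 // => j _; exact: sqr_ge0.
have [w /set_mem[wk wS] wmin] := EVT_min_rV (ex_intro _ _ A0)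
  (bounded_closed_compact Abd Acl) (@continuous_subspaceT _ _ A _ S_cont).
exists w^T => // v vk; apply: S_le; rewrite trmxK.
have [vS|/ltW vS] := leP (S v^T) (S 0); last exact: le_trans wS vS.
by apply: wmin; apply/mem_set; split=> //=; rewrite trmxK.
Qed.

(* The infima over monok k are minima. *)
Lemma inf_monok_min k (mu : 'cV[R]_n) : (1 <= k)%N ->
  exists2 u, monok k u &
    inf [set snorm (v - mu) | v in monok k] = snorm (u - mu) /\
    inf [set snorm (v - mu) ^+ 2 | v in monok k] = snorm (u - mu) ^+ 2.
Proof.
move=> /(monok_min_attained mu)[u uk umin]; exists u => //.
have infE (f : 'cV[R]_n -> R) : (forall v, monok k v -> f u <= f v) ->
    inf [set f v | v in monok k] = f u.
  move=> fmin; have lb : lbound [set f v | v in monok k] (f u).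
    by move=> _ [v vk <-]; exact: fmin.
  apply/eqP; rewrite eq_le; apply/andP; split.
    by apply: ge_inf; [exists (f u) | exists u].
  by apply: lb_le_inf => //; exists (f u), u.
split; first exact: (infE (fun v => snorm (v - mu))).
apply: (infE (fun v => snorm (v - mu) ^+ 2)) => v vk.
by rewrite lerXn2r ?nnegrE ?sqrtr_ge0 ?umin.
Qed.

End MonotoneMinimum.

Section Noise.
Context {d : measure_display} {T : measurableType d} {R : realType}.
Variable P : probability T R.

Definition mutually_independent n (X : 'I_n -> {RV P >-> R}) : Prop :=
  forall (I : {set 'I_n}) (A : 'I_n -> set R), (forall i, measurable (A i)) ->
    P [set w | forall i, i \in I -> A i (X i w)] =
    (\prod_(i in I) P (X i @^-1` A i))%E.

(* xi ~ N(0, sigma^2 I_n). The laws are only compared on measurable sets, as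
   measures are unconstrained elsewhere. The second argument of normal_prob is
   the standard deviation. *)
Definition gaussian_noise n (sigma : R) (xi : 'I_n -> {RV P >-> R}) : Prop :=
  mutually_independent xi /\
  forall i (A : set R), measurable A ->
    distribution P (xi i) A = normal_prob 0 sigma A.

Definition observation n (mu : 'cV[R]_n) (xi : 'I_n -> {RV P >-> R}) (w : T) :
  'cV[R]_n := mu + \col_i xi i w.

End Noise.

(* Main.v *)
Require Import Defs.
From HB Require Import structures.
From mathcomp Require Import all_boot all_order all_algebra.
From mathcomp Require Import all_classical all_reals all_analysis.
From mathcomp Require Import measurable_realfun ring lra.
Import Order.TTheory GRing.Theory Num.Theory.
Import numFieldNormedType.Exports.
Local Open Scope classical_set_scope.
Local Open Scope ring_scope.
Set Implicit Arguments.
Unset Strict Implicit.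
Unset Printing Implicit Defensive.

(** Write [|v|^2] for the unscaled sum of squares, [y = mu + xi],
    [beta = 46 sigma^2] and let [J] be the jump set of a closest point [u] of
    [mu] among the monotone vectors with at most [k] pieces, so that
    [#|J| < k] and [|PJ J *m mu - mu| <= |u - mu|].

    The criterion is a convex quadratic function of the weights. Its first
    order condition at a minimizer, in the direction of the vertex [J], holds
    with a strong convexity gain ([aggcrit_min]) and turns into
      [|muQ - mu|^2 <= |PJ J *m y - mu|^2 + penalty J + sum_K theta_K *
       (2 xi.v_K - |v_K|^2 / 2 - penalty K)],   [v_K = PJ K *m y - PJ J *m y].
    Since [v_K] lies in the space [VJ (K :|: J)], completing the square
    bounds [2 xi.v_K - |v_K|^2 / 2] by twice the squared length of the
    projection of [xi] on that space; nothing about [mu] is left. The noise in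
    [PJ J *m y] costs one more such term ([Q_oracle]). The space has dimension
    at most [#|K| + #|J| + 1], so the exponential moment of three times this
    squared length over [beta] is at most [(23 / 20) ^+ (#|K| + #|J| + 1)]
    ([energy_moment]), while the prior contains the factor [expR (- #|K|)] and
    [23 / 20 < expR 1]. The elementary bound [weighted_sum_le_exp] replaces the
    data-driven weights by a prior average of these exponential moments, which
    is bounded by a constant ([sum_prior_pow]). What remains is [penalty J],
    of order [sigma^2 k ln (e n / k)] by [penalty_le].

    The Gaussian moment only uses that the joint moment generating function of
    the noise is [expR (sigma^2 |a|^2 / 2)] ([noise_mgf]): each square in the
    exponent is linearized by an auxiliary one-dimensional Gaussian integral
    ([energy_mgf]).

    The bound on the norm itself follows from the one on its square, for if
    [X^2 <= a^2 + D] then [X <= a + rho / 2 + D / (2 rho)], and [rho] is taken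
    to be the square root of the bound on the expectation of [D]. *)

(** * Euclidean geometry of column vectors *)
Section Dot.
Context {R : realType} {n : nat}.
Implicit Types (u v w x : 'cV[R]_n).

Definition dot u v : R := \sum_(i < n) u i 0 * v i 0.

Lemma dotC u v : dot u v = dot v u.
Proof. by apply: eq_bigr => i _; rewrite mulrC. Qed.

Lemma dotDl u v w : dot (u + v) w = dot u w + dot v w.
Proof. by rewrite -big_split; apply: eq_bigr => i _; rewrite mxE mulrDl. Qed.

Lemma dotZl a u w : dot (a *: u) w = a * dot u w.
Proof. by rewrite mulr_sumr; apply: eq_bigr => i _; rewrite mxE mulrA. Qed.

Lemma dotNl u w : dot (- u) w = - dot u w.
Proof. by rewrite -scaleN1r dotZl mulN1r. Qed.

Lemma dotBl u v w : dot (u - v) w = dot u w - dot v w.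
Proof. by rewrite dotDl dotNl. Qed.

Lemma dot0l w : dot 0 w = 0.
Proof. by rewrite -(scale0r 0) dotZl mul0r. Qed.

Lemma dotDr u v w : dot w (u + v) = dot w u + dot w v.
Proof. by rewrite dotC dotDl !(dotC w). Qed.

Lemma dotZr a u w : dot w (a *: u) = a * dot w u.
Proof. by rewrite dotC dotZl (dotC w). Qed.

Lemma dotNr u w : dot w (- u) = - dot w u.
Proof. by rewrite dotC dotNl (dotC w). Qed.

Lemma dotBr u v w : dot w (u - v) = dot w u - dot w v.
Proof. by rewrite dotDr dotNr. Qed.

Lemma dot_suml (I : Type) (r : seq I) (F : I -> 'cV[R]_n) w :
  dot (\sum_(i <- r) F i) w = \sum_(i <- r) dot (F i) w.
Proof.
by elim: r => [|i r IH]; rewrite ?big_nil ?dot0l // !big_cons dotDl IH.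
Qed.

Lemma dot_sumr (I : Type) (r : seq I) (F : I -> 'cV[R]_n) w :
  dot w (\sum_(i <- r) F i) = \sum_(i <- r) dot w (F i).
Proof. by rewrite dotC dot_suml; apply: eq_bigr => i _; rewrite dotC. Qed.

Lemma dot_ge0 u : 0 <= dot u u.
Proof. by apply: sumr_ge0 => i _; rewrite -expr2 sqr_ge0. Qed.

Lemma dot_eq0 u : (dot u u == 0) = (u == 0).
Proof.
apply/eqP/eqP => [|->]; last by rewrite dot0l.
move=> u0; apply: tr_mul_eq0; apply/matrixP => i j.
rewrite !ord1 !mxE; apply: etrans u0.
by apply: eq_bigr => l _; rewrite mxE.
Qed.

Lemma snorm_sqr u : snorm u ^+ 2 = n%:R^-1 * dot u u.
Proof. by rewrite sqr_sqrtr // mulr_ge0 ?invr_ge0 // dot_ge0. Qed.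

(** Recursive, because both the Gram-Schmidt process and the computation of the
    Gaussian moment [energy_mgf] peel off the head of the family. *)
Fixpoint orthonormal (e : seq 'cV[R]_n) : Prop :=
  if e is x :: e' then
    [/\ dot x x = 1, forall z, z \in e' -> dot x z = 0 & orthonormal e']
  else True.

(** For an orthonormal [e], membership of [v] in the span of [e]. *)
Definition spans (e : seq 'cV[R]_n) v := v = \sum_(x <- e) dot v x *: x.

Lemma spansD e u v : spans e u -> spans e v -> spans e (u + v).
Proof.
rewrite /spans => uE vE; rewrite {1}uE {1}vE -big_split; apply: eq_bigr => x _.
by rewrite dotDl scalerDl.
Qed.

Lemma spansZ e a v : spans e v -> spans e (a *: v).
Proof.
rewrite /spans => vE; rewrite {1}vE scaler_sumr; apply: eq_bigr => x _.
by rewrite dotZl scalerA.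
Qed.

Lemma spans_sum (I : Type) (r : seq I) (P : pred I) (F : I -> 'cV[R]_n) e :
  (forall i, P i -> spans e (F i)) -> spans e (\sum_(i <- r | P i) F i).
Proof.
move=> eF; apply: (big_ind (spans e)) => //; last exact: spansD.
by rewrite /spans big1 // => x _; rewrite dot0l scale0r.
Qed.

Lemma spans_dot e u v : spans e v ->
  dot u v = \sum_(x <- e) dot v x * dot u x.
Proof.
move=> vE; rewrite {1}vE dot_sumr; apply: eq_bigr => x _.
by rewrite dotZr.
Qed.

(** Linear dependences are allowed: a vector whose residual vanishes adds
    nothing to the family. *)
Lemma gram_schmidt (s : seq 'cV[R]_n) :
  exists e, [/\ (size e <= size s)%N, orthonormal e &
                forall v, v \in s -> spans e v].
Proof.
elim: s => [|g s [e [es eo se]]]; first by exists [::].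
pose p := \sum_(x <- e) dot g x *: x; pose f := g - p.
have orthx : forall x, x \in e -> dot f x = 0.
  have H : forall e, orthonormal e -> forall x, x \in e ->
      \sum_(z <- e) dot g z * dot z x = dot g x.
    elim=> // z e' IH /= [z1 ze' oe'] x; rewrite inE big_cons => /predU1P[->|xe'].
      rewrite z1 mulr1 big_seq big1 ?addr0 // => t te'.
      by rewrite (dotC t) ze' // mulr0.
    by rewrite ze' // mulr0 add0r IH.
  move=> x xe; rewrite dotBl dot_suml -{1}(H e eo x xe) -sumrB.
  by rewrite big1 // => z _; rewrite dotZl subrr.
have [f0|f0] := eqVneq f 0.
  exists e; split=> //; first exact: leqW.
  move=> v; rewrite inE => /predU1P[->|/se //].
  by rewrite /spans; apply/eqP; rewrite -subr_eq0; apply/eqP.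
have nf : 0 < dot f f by rewrite lt_def dot_eq0 f0 dot_ge0.
pose c := (Num.sqrt (dot f f))^-1.
have c2 : c * (c * dot f f) = 1.
  by rewrite mulrA -expr2 /c exprVn sqr_sqrtr ?ltW// mulVf ?gt_eqF.
exists (c *: f :: e); split=> //=.
  split=> //; first by rewrite dotZl dotZr.
  by move=> z ze; rewrite dotZl orthx // mulr0.
move=> v; rewrite inE /spans big_cons => /predU1P[->|/se ev].
  have pf : dot p f = 0.
    rewrite dot_suml big_seq big1 // => x xe.
    by rewrite dotZl (dotC x) orthx // mulr0.
  have -> : dot g (c *: f) = c * dot f f.
    rewrite dotZr {2 3}/f; congr (_ * _).
    by rewrite -[in LHS](subrK p g) -/f dotDl pf addr0.
  by rewrite scalerA mulrC c2 scale1r -/p addrNK.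
have -> : dot v (c *: f) = 0.
  rewrite dotZr dotC (spans_dot _ ev) big_seq big1 ?mulr0 // => x xe.
  by rewrite orthx // mulr0.
by rewrite scale0r add0r.
Qed.

End Dot.

(** * Piecewise constant vectors and their projectors *)
Definition step {R : realType} {n} (i : 'I_n.-1) : 'cV[R]_n :=
  \col_j (i < j)%:R.

Section Piecewise.
Context {R : realType} {n : nat}.
Implicit Types (u v w x : 'cV[R]_n) (J K : {set 'I_n.-1}).

(** The value at the first coordinate, plus the jumps seen so far; the terms of
    the telescoping sum outside [J] vanish. *)
Lemma VJ_expansion J u (i0 : 'I_n) : i0 = 0%N :> nat -> VJ J u ->
  u = u i0 0 *: const_mx 1 +
      \sum_(i in J) (u (gapr i) 0 - u (gapl i) 0) *: step i.
Proof.
case: n J u i0 => [|m] J u i0 i00 uJ; first by case: i0 i00.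
pose f k : R := u (inord k) 0.
apply/matrixP => j z; rewrite ord1 !mxE summxE mulr1.
under eq_bigr do rewrite !mxE.
rewrite big_mkcond /=.
have -> : \sum_(i : 'I_m.+1.-1) (if i \in J then
    (u (gapr i) 0 - u (gapl i) 0) * (i < j)%:R else 0) =
    \sum_(i < m | (i < j)%N) (f i.+1 - f i).
  rewrite [RHS]big_mkcond; apply: eq_bigr => /= i _.
  have -> : f i.+1 = u (@gapr m.+1 i) 0.
    by congr (u _ 0); apply: val_inj; rewrite /= inordK // ltnS.
  have -> : f i = u (@gapl m.+1 i) 0.
    by congr (u _ 0); apply: val_inj; rewrite /= inordK // ltnS ltnW.
  case: ifP => iJ; case: ltnP => _; rewrite ?mulr1 ?mulr0 //.
  by rewrite uJ ?subrr // iJ.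
have jm : (j <= m)%N by rewrite -ltnS.
rewrite -(big_ord_widen m (fun k => f k.+1 - f k) jm).
rewrite -(big_mkord xpredT (fun k => f k.+1 - f k)) telescope_sumr //.
have -> : f j = u j 0 by rewrite /f inord_val.
have -> : f 0%N = u i0 0.
  by congr (u _ 0); apply: val_inj; rewrite /= inordK.
by rewrite addrC subrK.
Qed.

(** The dimension bound comes from the generating family made of the constant
    vector and one step per element of [J]. *)
Lemma VJ_orthonormal_basis J : exists e : seq 'cV[R]_n,
  [/\ (size e <= #|J|.+1)%N, orthonormal e & forall v, VJ J v -> spans e v].
Proof.
have [n0|n0] := posnP n.
  exists [::]; split=> // v _; rewrite /spans big_nil.
  by apply/matrixP => i; have := ltn_ord i; rewrite [X in (_ < X)%N]n0.
have [e [es eo se]] := gram_schmidt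
  ((const_mx 1 : 'cV[R]_n) :: [seq step i | i <- enum J]).
exists e; split=> //; first by rewrite (leq_trans es) //= size_map -cardE.
move=> v /(@VJ_expansion J v (Ordinal n0) erefl) ->; apply: spansD.
  by apply/spansZ/se; rewrite mem_head.
apply: spans_sum => i iJ; apply/spansZ/se; rewrite inE map_f ?orbT //.
by rewrite mem_enum.
Qed.

End Piecewise.

Section Projections.
Context {R : realType} {n : nat}.
Implicit Types (u v w x y : 'cV[R]_n) (J K : {set 'I_n.-1}).

Lemma VJS J K u : J \subset K -> VJ J u -> VJ K u.
Proof.
move=> JK uJ i iK; apply: uJ; apply: contra iK.
exact: (fintype.subsetP JK).
Qed.

Lemma VJB J u v : VJ J u -> VJ J v -> VJ J (u - v).
Proof. by move=> uJ vJ i iJ; rewrite !mxE uJ // vJ. Qed.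

Lemma PJ_in J x : VJ J (PJ J *m x).
Proof. by have [] := PJ_projector J x. Qed.

Lemma PJ_perp J x v : VJ J v -> dot v (x - PJ J *m x) = 0.
Proof.
move=> vJ; have [_ /(_ v vJ)] := PJ_projector J x.
move=> /matrixP/(_ 0 0); rewrite !mxE => vx; apply: etrans vx.
by apply: eq_bigr => i _; rewrite [v^T _ _]mxE.
Qed.

Lemma PJ_best J x u : VJ J u ->
  dot (PJ J *m x - x) (PJ J *m x - x) <= dot (u - x) (u - x).
Proof.
move=> uJ; set p := PJ J *m x.
have -> : u - x = (u - p) + (p - x) by rewrite addrA subrK.
have perp : dot (u - p) (p - x) = 0.
  rewrite -[p - x]opprB dotNr PJ_perp ?oppr0 //; apply: VJB => //.
  exact: PJ_in.
move: (u - p) (p - x) perp => v w perp.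
by rewrite dotDl !dotDr perp (dotC w) perp addr0 add0r lerDr dot_ge0.
Qed.

(** Squared length of the orthogonal projection of [xi] on the span of an
    orthonormal family. *)
Definition energy (xi : 'cV[R]_n) (e : seq 'cV[R]_n) := \sum_(x <- e) dot x xi ^+ 2.

(** Completing the square coordinate by coordinate in the family [e]. *)
Lemma spans_energy (a : R) xi e v : 0 < a -> spans e v ->
  2 * dot xi v - a * dot v v <= a^-1 * energy xi e.
Proof.
move=> a0 ev; rewrite !(spans_dot _ ev) /energy !mulr_sumr -sumrB.
apply: ler_sum => x _; rewrite (dotC xi); set c := dot v x; set d := dot x xi.
rewrite -subr_ge0.
have -> : a^-1 * d ^+ 2 - (2 * (c * d) - a * (c * c)) = a^-1 * (a * c - d) ^+ 2.
  by field; rewrite gt_eqF.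
by apply: mulr_ge0; rewrite ?sqr_ge0 // invr_ge0 ltW.
Qed.

(** By Pythagoras the noise enters only through its projection on [VJ J], which
    is no longer than the one on the larger space [VJ K]. *)
Lemma PJ_energy J K xi e mu : J \subset K ->
   (forall v, VJ K v -> spans e v) ->
   dot (PJ J *m (mu + xi) - mu) (PJ J *m (mu + xi) - mu) <=
   dot (PJ J *m mu - mu) (PJ J *m mu - mu) + energy xi e.
Proof.
move=> JK ee.
have -> : PJ J *m (mu + xi) - mu = (PJ J *m mu - mu) + PJ J *m xi.
  by rewrite mulmxDr addrAC.
have perp : dot (PJ J *m xi) (PJ J *m mu - mu) = 0.
  by rewrite -[_ - mu]opprB dotNr PJ_perp ?oppr0 //; exact: PJ_in.
set v := PJ J *m xi in perp *; move: (PJ J *m mu - mu) perp => w perp.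
rewrite dotDl !dotDr perp (dotC w) perp addr0 add0r lerD2l.
have vK : spans e v by apply: ee; apply: VJS JK _; exact: PJ_in.
have := spans_energy xi ltr01 vK.
have : dot v (xi - v) = 0 by apply: PJ_perp; exact: PJ_in.
rewrite dotBr (dotC v) => /eqP; rewrite subr_eq0 => /eqP ->.
by rewrite invr1 !mul1r; lra.
Qed.

End Projections.

(** * Minimizers of the aggregation criterion *)

(** If [b] were negative, a step [l] small compared with [- b / |c|] would
    contradict the hypothesis. *)
Lemma ge0_of_ge0_near0 (R : realFieldType) (b c : R) :
  (forall l, 0 < l -> l <= 1 -> 0 <= b + l * c) -> 0 <= b.
Proof.
move=> H; rewrite leNgt; apply/negP => b0.
have c1 : 0 < 1 + `|c| by rewrite ltr_pwDl.
pose l := Num.min 1 (- b / 2 / (1 + `|c|)).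
have l0 : 0 < l by rewrite lt_min ltr01 !divr_gt0 // oppr_gt0.
have := H l l0; rewrite ge_min lexx => /(_ isT).
have : l * c <= - b / 2.
  have lc : l <= - b / 2 / (1 + `|c|) by rewrite ge_min lexx orbT.
  rewrite (le_trans (ler_norm _)) // normrM (gtr0_norm l0).
  apply: le_trans (_ : l * (1 + `|c|) <= _); last by rewrite -ler_pdivlMr.
  by rewrite ler_pM2l // lerDr.
lra.
Qed.

(** The criterion is studied for arbitrary candidates [p k] and penalties
    [a k], with the unscaled norm. *)
Section Weights.
Context {R : realType} {n : nat} {I : finType}.
Variables (p : I -> 'cV[R]_n) (a th : I -> R) (y : 'cV[R]_n).
Implicit Types (u v : 'cV[R]_n) (j k : I).

Let mix (w : I -> R) : 'cV[R]_n := \sum_k w k *: p k.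

Definition aggcrit (w : I -> R) : R :=
  dot (mix w - y) (mix w - y) +
  \sum_k w k * (2^-1 * dot (mix w - p k) (mix w - p k) + a k).

Let dot_mix w u : dot (mix w) u = \sum_k w k * dot (p k) u.
Proof. by rewrite dot_suml; apply: eq_bigr => k _; rewrite dotZl. Qed.

Let sum_dist w u : \sum_k w k = 1 ->
  \sum_k w k * dot (p k - u) (p k - u) =
  \sum_k w k * dot (p k) (p k) - 2 * dot (mix w) u + dot u u.
Proof.
move=> w1; rewrite dot_mix mulr_sumr -sumrB -[dot u u]mul1r.
rewrite -[X in X * dot u u]w1 mulr_suml -big_split; apply: eq_bigr => k _ /=.
by rewrite dotBl !dotBr (dotC u (p k)); ring.
Qed.

(** On the simplex the variance identity turns the criterion into the sum of a
    quadratic function of the mixture and an affine function of the weights. *)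
Lemma aggcrit_split w : \sum_k w k = 1 ->
  aggcrit w = 2^-1 * dot (mix w - y) (mix w - y) +
    \sum_k w k * (2^-1 * dot (p k - y) (p k - y) + a k).
Proof.
move=> w1; rewrite /aggcrit.
have E u : \sum_k w k * (2^-1 * dot (p k - u) (p k - u) + a k) =
    2^-1 * (\sum_k w k * dot (p k) (p k) - 2 * dot (mix w) u + dot u u) +
    \sum_k w k * a k.
  rewrite -(sum_dist _ w1) mulr_sumr -big_split; apply: eq_bigr => k _ /=.
  by ring.
under eq_bigr do rewrite -opprB dotNl dotNr opprK.
by rewrite !E !dotBl !dotBr (dotC y); field.
Qed.

Hypothesis th0 : forall k, 0 <= th k.
Hypothesis th1 : \sum_k th k = 1.
Hypothesis th_min : forall w, (forall k, 0 <= w k) -> \sum_k w k = 1 ->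
  aggcrit th <= aggcrit w.

(** Moving the mass [l] from the minimizer to the vertex [j] and letting [l] tend
    to zero gives the first order condition. Rewritten with the variance
    identity, it contains the gain of half the mean of
    [dot (p k - p j) (p k - p j)], the negative term that later absorbs the
    noise. *)
Lemma aggcrit_min j :
  dot (mix th - y) (mix th - y) <= dot (p j - y) (p j - y) + a j -
    \sum_k th k * (a k + 2^-1 * dot (p k - p j) (p k - p j)).
Proof.
pose b k := 2^-1 * dot (p k - y) (p k - y) + a k.
have first_order : 0 <=
    dot (mix th - y) (p j - mix th) + b j - \sum_k th k * b k.
  apply: (@ge0_of_ge0_near0 _ _ (2^-1 * dot (p j - mix th) (p j - mix th))).
  move=> l l0 l1; pose w k := (1 - l) * th k + l * (k == j)%:R.
  have pick (V : lmodType R) (F : I -> V) : \sum_k (k == j)%:R *: F k = F j.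
    rewrite (bigD1 j) //= eqxx scale1r big1 ?addr0 // => k /negPf ->.
    by rewrite scale0r.
  have w0 k : 0 <= w k.
    by rewrite addr_ge0 // mulr_ge0 ?subr_ge0 // ltW.
  have sum_w (F : I -> R) :
      \sum_k w k * F k = (1 - l) * (\sum_k th k * F k) + l * F j.
    rewrite -(pick R^o F) !mulr_sumr -big_split; apply: eq_bigr => k _ /=.
    by rewrite /w /GRing.scale /=; ring.
  have w1 : \sum_k w k = 1.
    have := sum_w (fun=> 1); under eq_bigr do rewrite mulr1.
    under [X in (1 - l) * X]eq_bigr do rewrite mulr1.
    by move=> ->; rewrite th1; ring.
  have mixw : mix w - y = (mix th - y) + l *: (p j - mix th).
    rewrite /mix -{1}(pick _ p) scalerBr addrAC addrA; congr (_ - y).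
    rewrite !scaler_sumr -big_split -sumrB; apply: eq_bigr => k _ /=.
    rewrite /w !scalerDl !scalerA mulrBl mul1r scalerBl.
    by rewrite addrAC.
  have := th_min w0 w1; rewrite !aggcrit_split // mixw sum_w -/(b j).
  rewrite -/(\sum_k th k * b k); set S := \sum_k _.
  move: (mix th - y) (p j - mix th) => u v.
  rewrite !(dotDl, dotDr, dotZl, dotZr) (dotC v u).
  move=> H; rewrite -(pmulr_rge0 _ l0).
  rewrite -subr_ge0 in H; apply: le_trans H _; rewrite le_eqVlt.
  by apply/orP; left; apply/eqP; field.
apply: le_trans (_ : _ <= dot (mix th - y) (mix th - y) +
  (dot (mix th - y) (p j - mix th) + b j - \sum_k th k * b k)) _.
  by rewrite lerDl.
have E (F G : I -> R) (c : R) : \sum_k th k * (F k + c * G k) =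
    \sum_k th k * F k + c * \sum_k th k * G k.
  by rewrite mulr_sumr -big_split; apply: eq_bigr => k _ /=; ring.
rewrite E /b; under [X in _ + (_ - X)]eq_bigr do rewrite addrC.
rewrite E !(sum_dist _ th1) !(dotBl, dotBr) !(dotC _ (mix th)) (dotC y (p j)).
set S := \sum_k _; set S2 := \sum_k _.
lra.
Qed.

End Weights.

(** * Deterministic oracle inequality *)
Section Oracle.
Context {R : realType} {n : nat}.
Implicit Types (u v w x y mu xi : 'cV[R]_n) (J K : {set 'I_n.-1}).

(** Coefficient of the weight of [J] in [n] times the criterion, apart from
    the distance to the mixture. *)
Definition penalty (sigma : R) J : R :=
  2 * sigma ^+ 2 * #|J|%:R + 46 * sigma ^+ 2 * ln (1 / prior J).

Lemma Qcrit_aggcrit sigma y (w : {set 'I_n.-1} -> R) : (0 < n)%N ->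
  n%:R * Qcrit sigma y w =
  aggcrit (fun J => PJ J *m y) (penalty sigma) y w.
Proof.
move=> n0; have nn : n%:R != 0 :> R by rewrite pnatr_eq0 -lt0n.
rewrite /Qcrit mulrDr snorm_sqr mulrA divff // mul1r; congr (_ + _).
rewrite mulr_sumr; apply: eq_bigr => J _.
by rewrite snorm_sqr /penalty /mu_of; field.
Qed.

(** The vectors [PJ K *m y - PJ J *m y] and [PJ J *m xi] both belong to
    [VJ (K :|: J)], spanned by [e K]: the first contributes twice the energy of
    the noise, with half of the squared length compensated by [aggcrit_min],
    the second contributes it once. *)
Lemma Q_oracle sigma mu xi th J (e : {set 'I_n.-1} -> seq 'cV[R]_n) :
  (0 < n)%N -> is_Q_weights sigma (mu + xi) th ->
  (forall K v, VJ (K :|: J) v -> spans (e K) v) ->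
  dot (mu_of th (mu + xi) - mu) (mu_of th (mu + xi) - mu) <=
    dot (PJ J *m mu - mu) (PJ J *m mu - mu) + penalty sigma J +
    \sum_K th K * (3 * energy xi (e K) - penalty sigma K).
Proof.
move=> n0 [[th0 th1] thmin] espan; set y := mu + xi.
pose p K := PJ K *m y; pose d v := dot v v.
have n0R : 0 < n%:R :> R by rewrite ltr0n.
have agg_min (w : {set 'I_n.-1} -> R) : (forall k, 0 <= w k) -> \sum_k w k = 1 ->
    aggcrit p (penalty sigma) y th <= aggcrit p (penalty sigma) y w.
  by move=> w0 w1; rewrite -!Qcrit_aggcrit // ler_pM2l //; exact: thmin.
have := aggcrit_min th0 th1 agg_min J.
rewrite -/(mu_of th y) -/(d (_ - y)) -/(d (p J - y)) -/(d (_ - mu)).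
set M := mu_of th y.
have shift v : d (v - mu) = d (v - y) + 2 * dot xi (v - y) + d xi.
  have -> : v - mu = (v - y) + xi by rewrite opprD addrA subrK.
  by rewrite /d; move: (v - y) => z; rewrite dotDl !dotDr (dotC z xi); ring.
have mixE u : dot xi (M - u) = \sum_K th K * dot xi (p K - u).
  rewrite dotBr dot_sumr -[dot xi u]mul1r -[X in X * dot xi u]th1 mulr_suml.
  by rewrite -sumrB; apply: eq_bigr => K _; rewrite dotZr dotBr mulrBr.
have dJ K : d (p J - mu) <=
    dot (PJ J *m mu - mu) (PJ J *m mu - mu) + energy xi (e K).
  apply: (@PJ_energy _ _ J (K :|: J)) => [|v]; last exact: espan.
  exact: finset.subsetUr.
have dK K : 2 * dot xi (p K - p J) - 2^-1 * d (p K - p J) <=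
    2 * energy xi (e K).
  have h0 : 0 < 2^-1 :> R by rewrite invr_gt0.
  have := @spans_energy _ _ _ xi (e K) (p K - p J) h0; rewrite invrK; apply.
  apply: espan; apply: VJB.
    by apply: (VJS (finset.subsetUl K J)); exact: PJ_in.
  by apply: (VJS (finset.subsetUr K J)); exact: PJ_in.
set D := dot (PJ J *m mu - mu) _ in dJ *.
move=> min_J.
have -> : d (M - mu) =
    d (M - y) - d (p J - y) + 2 * dot xi (M - p J) + d (p J - mu).
  have -> : dot xi (M - p J) = dot xi (M - y) - dot xi (p J - y).
    by rewrite -dotBr opprB addrA subrK.
  by rewrite !shift; ring.
rewrite mixE.
apply: le_trans (_ : _ <= penalty sigma J + \sum_K th K *
  (2 * dot xi (p K - p J) - 2^-1 * d (p K - p J) - penalty sigma K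
   + d (p J - mu))) _.
  have -> : \sum_K th K * (2 * dot xi (p K - p J) - 2^-1 * d (p K - p J) -
      penalty sigma K + d (p J - mu)) =
      2 * (\sum_K th K * dot xi (p K - p J)) -
      \sum_K th K * (penalty sigma K + 2^-1 * d (p K - p J)) + d (p J - mu).
    rewrite -[X in _ = _ + X]mul1r -[X in _ = _ + X * _]th1 mulr_suml mulr_sumr.
    by rewrite -sumrB -big_split; apply: eq_bigr => K _ /=; ring.
  by rewrite -/(d _) in min_J *; lra.
have -> : D = \sum_K th K * D by rewrite -mulr_suml th1 mul1r.
rewrite [leRHS]addrAC [leLHS]addrC lerD2r -big_split; apply: ler_sum => K _ /=.
rewrite -mulrDr ler_wpM2l //; have := dJ K; have := dK K; lra.
Qed.

(** A linearized form of the duality between relative entropy and the log-Laplace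
    transform: from [1 + x <= expR x] each term is below
    [m + q i * expR (f i - m)], and the second summand is one of those on the
    right. The weights [th] may depend on the noise; the right-hand side does
    not involve them. *)
Lemma weighted_sum_le_exp (I : finType) (th f q : I -> R) (m : R) :
  (forall i, 0 <= th i) -> \sum_i th i = 1 -> (forall i, 0 < q i) ->
  \sum_i th i * (f i - ln (1 / q i)) <=
  m + expR (- m) * \sum_i q i * expR (f i).
Proof.
move=> th0 th1 q0; set S := expR _ * _.
have -> : m + S = \sum_i th i * (m + S) by rewrite -mulr_suml th1 mul1r.
apply: ler_sum => i _; rewrite ler_wpM2l //.
rewrite div1r lnV ?posrE // opprK.
apply: le_trans (_ : m + expR (f i + ln (q i) - m) <= _).
  by have := expR_ge1Dx (f i + ln (q i) - m); lra.
rewrite lerD2l [f i + _]addrC [_ - m]addrC !expRD lnK ?posrE //.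
rewrite ler_wpM2l ?expR_ge0 // (bigD1 i) //= lerDl.
by apply: sumr_ge0 => k _; rewrite mulr_ge0 ?expR_ge0 // ltW.
Qed.

Lemma Hsum_ge1 : (0 < n)%N -> 1 <= @Hsum R n.
Proof.
case: n => // m _; rewrite /Hsum (bigD1 ord0) //= oppr0 expR0 lerDl.
by apply: sumr_ge0 => i _; exact: expR_ge0.
Qed.

Lemma Hsum_gt0 : (0 < n)%N -> 0 < @Hsum R n.
Proof. by move=> n0; exact: lt_le_trans ltr01 (Hsum_ge1 n0). Qed.

Lemma card_bin_gt0 J : (0 < 'C(n.-1, #|J|))%N.
Proof.
by rewrite bin_gt0 -[X in (_ <= X)%N](card_ord n.-1) max_card.
Qed.

Lemma prior_gt0 J : (0 < n)%N -> 0 < @prior R n J.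
Proof.
move=> n0; rewrite divr_gt0 ?expR_gt0 // mulr_gt0 ?Hsum_gt0 // ltr0n.
exact: card_bin_gt0.
Qed.

(** The bound holds for every [m]; the useful choice makes [expR (- m)] cancel
    the exponential cost of the dimension of [VJ J] in all the terms. *)
Lemma Q_oracle_exp sigma mu xi th J (e : {set 'I_n.-1} -> seq 'cV[R]_n) m :
  (0 < n)%N -> 0 < sigma -> is_Q_weights sigma (mu + xi) th ->
  (forall K v, VJ (K :|: J) v -> spans (e K) v) ->
  dot (mu_of th (mu + xi) - mu) (mu_of th (mu + xi) - mu) <=
    dot (PJ J *m mu - mu) (PJ J *m mu - mu) + penalty sigma J +
    46 * sigma ^+ 2 * (m + expR (- m) * \sum_K prior K *
       expR (3 / (46 * sigma ^+ 2) * energy xi (e K))).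
Proof.
move=> n0 s0 Q espan; apply: le_trans (Q_oracle n0 Q espan) _.
rewrite lerD2l; have [[th0 th1] _] := Q.
have b0 : 0 < 46 * sigma ^+ 2 by rewrite mulr_gt0 // exprn_gt0.
have := @weighted_sum_le_exp _ th
  (fun K => 3 / (46 * sigma ^+ 2) * energy xi (e K)) (@prior R n) m th0 th1
  (fun K => prior_gt0 K n0).
rewrite -(ler_pM2l b0); apply: le_trans.
rewrite mulr_sumr; apply: ler_sum => K _.
rewrite mulrCA ler_wpM2l // mulrBr /penalty.
have -> : 46 * sigma ^+ 2 * (3 / (46 * sigma ^+ 2) * energy xi (e K)) =
    3 * energy xi (e K) by field; rewrite gt_eqF.
rewrite lerD2l lerN2 lerDr; apply: mulr_ge0 => //; apply: mulr_ge0 => //.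
exact: sqr_ge0.
Qed.

End Oracle.

(** * Integrals of nonnegative functions *)
Section Monotone.
Local Open Scope ereal_scope.
Context d (T : measurableType d) (R : realType) (m : {measure set T -> \bar R}).

(** The integral of a nonnegative function is a supremum over the simple
    functions below it. This serves for the loss of the estimator, built from an
    arbitrary selection of minimizing weights. *)
Lemma ge0_integral_mono (f g : T -> \bar R) :
  (forall x, 0 <= f x) -> (forall x, f x <= g x) ->
  \int[m]_x f x <= \int[m]_x g x.
Proof.
move=> f0 fg; rewrite !ge0_integralTE //; last first.
  by move=> x; exact: le_trans (f0 x) (fg x).
by apply: le_ereal_sup => _ [h /= hf <-]; exists h => //= x; exact: le_trans (hf x) _.
Qed.

End Monotone.

Section LayerCake.
Local Open Scope ereal_scope.
Context {R : realType}.
Notation leb := (@lebesgue_measure R).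

(** The slice at height [t] of the subgraph of [f]. *)
Definition level (f : R -> R) (t : R) : set R :=
  [set z | (0 <= t < f z)%R].

Lemma measurable_level f t : measurable_fun setT f -> measurable (level f t).
Proof.
move=> mf; have -> : level f t = setT `&` (fun z => (0 <= t < f z)%R) @^-1` [set true].
  by rewrite setTI.
suff : measurable_fun setT (fun z => (0 <= t < f z)%R) by apply.
by apply: measurable_and => //; exact: measurable_fun_ltr.
Qed.

(** The integral of a nonnegative function is the area of its subgraph, whose
    slices are exchanged with the integral over [m] by Tonelli. *)
Lemma layer_cake d (T : measurableType d)
    (m : {sigma_finite_measure set T -> \bar R})
    (g : T -> \bar R) (X : T -> R) (f : R -> R) :
  measurable_fun setT g -> (forall x, 0 <= g x) ->
  measurable_fun setT X -> measurable_fun setT f -> (forall x, (0 <= f x)%R) ->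
  \int[m]_x (g x * (f (X x))%:E) =
  \int[leb]_t \int[m]_x (g x * (\1_(level f t) (X x))%:E).
Proof.
move=> mg g0 mX mf f0.
pose F (p : T * R) : \bar R := g p.1 * (\1_(level f p.2) (X p.1))%:E.
have mF : measurable_fun setT F.
  apply: emeasurable_funM; first exact: (measurableT_comp mg).
  apply/measurable_EFinP.
  pose b (q : T * R) := (0 <= q.2 < f (X q.1))%R.
  have mb : measurable_fun setT b.
    apply: measurable_and; first exact: measurable_fun_ler.
    apply: measurable_fun_ltr => //.
    by apply: (measurableT_comp mf); exact: (measurableT_comp mX).
  suff : measurable_fun setT (\1_[set q | b q] : T * R -> R).
    by congr measurable_fun; apply/funext => q; rewrite /= !indicE !inE.
  apply: measurable_indic; rewrite -[X in measurable X]setTI.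
  exact: (mb measurableT [set true]).
have F0 p : 0 <= F p by rewrite /F mule_ge0 // lee_fin.
transitivity (\int[m]_x \int[leb]_t F (x, t)).
  apply: eq_integral => x _; rewrite /F /=.
  transitivity (g x * \int[leb]_t (\1_(`[0%R, f (X x)[%classic) t)%:E).
    rewrite integral_indic // setIT; congr (_ * _).
    apply/esym/(etrans (lebesgue_measure_itv _)); rewrite /= lte_fin.
    case: ltP (f0 (X x)) => [_ _|a b]; rewrite ?oppr0 ?adde0 //.
    by congr (_%:E); apply/eqP; rewrite eq_le a b.
  rewrite -ge0_integralZl //; last by apply/measurable_EFinP; exact: measurable_indic.
exact: (@fubini_tonelli _ _ _ _ _ m leb F mF F0).
Qed.

End LayerCake.

Section SameLaw.
Local Open Scope ereal_scope.
Context {R : realType}.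
Notation leb := (@lebesgue_measure R).

(** By the layer cake formula the integrals are determined by their values on
    events. With [g1] a function of the other variables and [g2] a density,
    this turns independence of events into a product formula. *)
Lemma same_law_integral d1 (T1 : measurableType d1)
    (m1 : {sigma_finite_measure set T1 -> \bar R}) (g1 : T1 -> \bar R)
    (X1 : T1 -> R) d2 (T2 : measurableType d2)
    (m2 : {sigma_finite_measure set T2 -> \bar R}) (g2 : T2 -> \bar R)
    (X2 : T2 -> R) (f : R -> R) :
  measurable_fun setT g1 -> (forall x, 0 <= g1 x) -> measurable_fun setT X1 ->
  measurable_fun setT g2 -> (forall x, 0 <= g2 x) -> measurable_fun setT X2 ->
  (forall A : set R, measurable A -> \int[m1]_x (g1 x * (\1_A (X1 x))%:E) =
                                     \int[m2]_x (g2 x * (\1_A (X2 x))%:E)) ->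
  measurable_fun setT f -> (forall x, (0 <= f x)%R) ->
  \int[m1]_x (g1 x * (f (X1 x))%:E) = \int[m2]_x (g2 x * (f (X2 x))%:E).
Proof.
move=> mg1 g10 mX1 mg2 g20 mX2 same mf f0; rewrite !layer_cake //.
by apply: eq_integral => t _; apply: same; exact: measurable_level.
Qed.

End SameLaw.

(** * Exponential moments of Gaussian noise *)
Section Gaussian.
Context {R : realType}.
Notation leb := (@lebesgue_measure R).

(** Completing the square in the exponent shifts the mean of the density to
    [a * s ^+ 2]. *)
Lemma gauss_mgf (s a : R) : 0 < s ->
  (\int[leb]_x ((normal_pdf 0 s x)%:E * (expR (a * x))%:E) =
   (expR (s ^+ 2 / 2 * a ^+ 2))%:E)%E.
Proof.
move=> s0; transitivity (\int[leb]_x ((expR (s ^+ 2 / 2 * a ^+ 2))%:E *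
    (normal_pdf (a * s ^+ 2) s x)%:E))%E.
  apply: eq_integral => x _; rewrite -!EFinM !normal_pdfE ?gt_eqF //=.
  congr (_%:E); rewrite [RHS]mulrCA -[LHS]mulrA; congr (_ * _).
  by rewrite /normal_fun -!expRD; congr expR; field; rewrite gt_eqF.
rewrite ge0_integralZl //.
- by rewrite integral_normal_pdf mule1.
- by apply/measurable_EFinP; exact: measurable_normal_pdf.
- by move=> x _; rewrite lee_fin normal_pdf_ge0.
Qed.

(** The integrand is [r / t] times the centered Gaussian density with standard
    deviation [r]. *)
Lemma gauss_exp_sqr (s t r : R) : 0 < t -> 0 < r ->
  t ^- 2 = r ^- 2 + s ^+ 2 ->
  (\int[leb]_x ((normal_pdf 0 t x)%:E * (expR (s ^+ 2 / 2 * x ^+ 2))%:E) =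
   (r / t)%:E)%E.
Proof.
move=> t0 r0 trs; transitivity (\int[leb]_x ((r / t)%:E *
    (normal_pdf 0 r x)%:E))%E.
  apply: eq_integral => x _; rewrite -!EFinM !normal_pdfE ?gt_eqF //=.
  have peak (u : R) : 0 < u -> normal_peak u = u^-1 * (Num.sqrt (pi *+ 2))^-1.
    move=> u0; rewrite /normal_peak -mulrnAr sqrtrM ?sqr_ge0 // sqrtr_sqr.
    by rewrite gtr0_norm // invfM.
  congr (_%:E); rewrite !peak //.
  have -> : r / t * (r^-1 / Num.sqrt (pi *+ 2) * normal_fun 0 r x) =
    t^-1 / Num.sqrt (pi *+ 2) * normal_fun 0 r x.
    by move: (Num.sqrt _)^-1 (normal_fun _ _ _) => q f; field; rewrite !gt_eqF.
  rewrite -[LHS]mulrA; congr (_ * _).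
  rewrite /normal_fun -expRD; congr expR.
  have -> : s ^+ 2 = t ^- 2 - r ^- 2 by rewrite trs addrAC subrr add0r.
  by field; rewrite !gt_eqF.
rewrite ge0_integralZl //.
- by rewrite integral_normal_pdf mule1.
- by apply/measurable_EFinP; exact: measurable_normal_pdf.
- by move=> x _; rewrite lee_fin normal_pdf_ge0.
- by rewrite lee_fin divr_ge0 ?ltW.
Qed.

End Gaussian.

Section Noise.
Context {d : measure_display} {T : measurableType d} {R : realType}.
Context (P : probability T R) (n : nat) (s : R) (xi : 'I_n -> {RV P >-> R}).
Notation leb := (@lebesgue_measure R).
Hypothesis s0 : 0 < s.
Hypothesis noise : gaussian_noise s xi.

(** The expectation of a product over the coordinates is computed by turning the
    indicators of events into exponentials one coordinate at a time; [S] lists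
    the coordinates already treated. *)
Let factor (a : 'I_n -> R) (A : 'I_n -> set R) (S : seq 'I_n) i (z : R) : R :=
  if i \in S then expR (a i * z) else \1_(A i) z.

Let moment (a : 'I_n -> R) (A : 'I_n -> set R) (S : seq 'I_n) i : \bar R :=
  if i \in S then (expR (s ^+ 2 / 2 * a i ^+ 2))%:E else P (xi i @^-1` A i).

Let factor_ge0 a A S i z : 0 <= factor a A S i z.
Proof. by rewrite /factor; case: ifP; rewrite ?expR_ge0. Qed.

Let factor_meas a A S i : measurable (A i) ->
  measurable_fun setT (fun w => factor a A S i (xi i w)).
Proof.
move=> mA; rewrite /factor; case: (i \in S).
  by apply: measurableT_comp => //; exact: measurable_funM.
exact: (measurableT_comp (measurable_indic mA)).
Qed.

(** With no exponential this is independence. When the coordinate [j] is added,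
    the induction hypothesis for all choices of the event [A j] says that [xi j]
    has a Gaussian density under the measure weighted by the other factors. *)
Let expectation_factors a A S : (forall i, measurable (A i)) ->
  (\int[P]_w (\prod_i factor a A S i (xi i w))%:E = \prod_i moment a A S i)%E.
Proof.
elim: S A => [|j S IH] A mA.
  have [ind _] := noise.
  transitivity (\int[P]_w (\1_[set w | forall i, i \in [set: 'I_n]%SET ->
      A i (xi i w)] w)%:E)%E.
    apply: eq_integral => w _; congr (_%:E); rewrite /factor /= indicE.
    case: (boolP (w \in _)) => [|/negP] h.
      apply: big1 => i _; rewrite indicE mem_set //.
      by move/set_mem : h; apply; rewrite inE.
    have [/forallP H|] := boolP [forall i, xi i w \in A i].
      by exfalso; apply: h; apply/mem_set => i _; apply/set_mem.
    rewrite negb_forall => /existsP[i /negPf iA].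
    by rewrite (bigD1 i) //= indicE iA mul0r.
  rewrite integral_indic // ?setIT; last first.
    rewrite [X in measurable X](_ : _ = \bigcap_(i in [set: 'I_n]) (xi i @^-1` A i)).
      by apply: fin_bigcap_measurable => // i _; exact: measurable_funPTI.
    by apply/seteqP; split=> w H i _; exact: H.
  apply: etrans (ind [set: 'I_n]%SET A mA) _.
  by apply: eq_bigl => i; rewrite inE.
have [jS|jS] := boolP (j \in S).
  have E i : (i \in j :: S) = (i \in S).
    by rewrite inE; case: eqVneq => // ->; rewrite jS.
  transitivity (\int[P]_w (\prod_i factor a A S i (xi i w))%:E)%E.
    by apply: eq_integral => w _; congr _%:E; apply: eq_bigr => i _; rewrite /factor E.
  by rewrite IH //; apply: eq_bigr => i _; rewrite /moment E.
pose K := (\prod_(i < n | i != j) moment a A S i)%E.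
pose g w := (\prod_(i < n | i != j) factor a A S i (xi i w))%:E.
have K0 : (0 <= K)%E.
  apply: prode_ge0 => i _; rewrite /moment.
  by case: ifP => _; rewrite ?lee_fin ?expR_ge0 ?measure_ge0.
have E i : i != j -> (i \in j :: S) = (i \in S) by move=> /negPf ij; rewrite inE ij.
transitivity (\int[P]_w (g w * (expR (a j * xi j w))%:E))%E.
  apply: eq_integral => w _; rewrite -EFinM (bigD1 j) //= mulrC.
  rewrite {2}/factor mem_head; congr (_ * _)%:E; apply: eq_bigr => i /E ij.
  by rewrite /factor ij.
have mg : measurable_fun setT g.
  apply/measurable_EFinP; under eq_fun do rewrite -big_filter.
  by apply: measurable_prod => i _; exact: factor_meas.
transitivity (\int[leb]_x ((K * (normal_pdf 0 s x)%:E) * (expR (a j * x))%:E))%E.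
  apply: (@same_law_integral R _ _ P g (xi j) _ _ leb
    (fun x => K * (normal_pdf 0 s x)%:E)%E id (fun x => expR (a j * x))) => //.
  - by move=> w; rewrite lee_fin prodr_ge0 // => i _; exact: factor_ge0.
  - apply: measurable_funeM; apply/measurable_EFinP.
    exact: measurable_normal_pdf.
  - by move=> x; rewrite mule_ge0 // lee_fin normal_pdf_ge0.
  - move=> B mB; pose A' i := if i == j then B else A i.
    have mA' i : measurable (A' i) by rewrite /A'; case: ifP.
    transitivity (\int[P]_w (\prod_i factor a A' S i (xi i w))%:E)%E.
      apply: eq_integral => w _; rewrite -EFinM [in RHS](bigD1 j) //= mulrC.
      rewrite /factor /A' eqxx (negPf jS); congr (_ * _)%:E.
      by apply: eq_bigr => i /negPf ->.
    rewrite IH // (bigD1 j) //= muleC.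
    have -> : (\prod_(i < n | i != j) moment a A' S i = K)%E.
      by apply: eq_bigr => i /negPf ij; rewrite /moment /A' ij.
    rewrite /moment (negPf jS) /A' eqxx.
    have [_ /(_ j B mB) law] := noise.
    under [RHS]eq_integral do rewrite -muleA.
    rewrite ge0_integralZl //; first last.
    + by move=> x _; rewrite mule_ge0 // lee_fin ?normal_pdf_ge0.
    + apply: emeasurable_funM; apply/measurable_EFinP.
        exact: measurable_normal_pdf.
      exact: measurable_indic.
    congr (_ * _)%E; apply: etrans law _; rewrite /normal_prob [LHS]integral_mkcond.
    apply: eq_integral => x _; rewrite patchE indicE.
    by case: ifP; rewrite ?mule1 ?mule0.
  - by apply: measurableT_comp => //; exact: measurable_funM.
under eq_integral do rewrite -muleA.
rewrite ge0_integralZl //; first last.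
- by move=> x _; rewrite mule_ge0 // lee_fin ?normal_pdf_ge0 ?expR_ge0.
- apply: emeasurable_funM; apply/measurable_EFinP.
    exact: measurable_normal_pdf.
  by apply: measurableT_comp => //; exact: measurable_funM.
rewrite gauss_mgf // [RHS](bigD1 j) //= muleC {1}/moment mem_head.
by congr (_ * _)%E; apply: eq_bigr => i /E ij; rewrite /moment ij.
Qed.

Let Xi w : 'cV[R]_n := \col_i xi i w.

Lemma noise_mgf a :
  (\int[P]_w (expR (dot a (Xi w)))%:E = (expR (s ^+ 2 / 2 * dot a a))%:E)%E.
Proof.
have := @expectation_factors (fun i => a i 0) (fun=> setT) (enum 'I_n).
move=> /(_ (fun=> measurableT)) H; apply: etrans (etrans _ H) _.
  apply: eq_integral => w _; congr _%:E; rewrite /dot expR_sum.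
  by apply: eq_bigr => i _; rewrite /factor mem_enum mxE.
under eq_bigr do rewrite /moment mem_enum /=.
rewrite prodEFin; congr _%:E; rewrite /dot mulr_sumr expR_sum.
by apply: eq_bigr => i _; rewrite expr2.
Qed.

Lemma measurable_dot_noise a : measurable_fun setT (fun w => dot a (Xi w)).
Proof.
apply: measurable_sum => i; apply: measurable_funM => //.
have -> : (fun w => Xi w i 0) = xi i by apply/funext => w; rewrite mxE.
exact: measurable_funP.
Qed.

Lemma measurable_energy (e : seq 'cV[R]_n) :
  measurable_fun setT (fun w => energy (Xi w) e).
Proof.
apply: measurable_sum => x; apply: measurable_funX.
exact: measurable_dot_noise.
Qed.

(** The head [x] of the family is removed by writing
    [expR (t ^+ 2 / 2 * dot x xi ^+ 2)] as the integral of
    [expR (l * dot x xi)] against a centered Gaussian in [l] with standard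
    deviation [t], and by exchanging integrals. The induction hypothesis
    applies to [a + l *: x], which is still orthogonal to the rest of the
    family; what remains is a Gaussian integral in [l] given by
    [gauss_exp_sqr]. *)
Lemma energy_mgf (t r : R) (e : seq 'cV[R]_n) : 0 < t -> 0 < r ->
  t ^- 2 = r ^- 2 + s ^+ 2 -> orthonormal e ->
  forall a, (forall x, x \in e -> dot a x = 0) ->
  (\int[P]_w (expR (dot a (Xi w)) * expR (t ^+ 2 / 2 * energy (Xi w) e))%:E =
   ((r / t) ^+ size e * expR (s ^+ 2 / 2 * dot a a))%:E)%E.
Proof.
move=> t0 r0 trs; elim: e => [_|x e IH [x1 xe oe]] a ae.
  under eq_integral do rewrite /energy big_nil mulr0 expR0 mulr1.
  by rewrite noise_mgf expr0 mul1r.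
have ax : dot a x = 0 by apply: ae; rewrite mem_head.
pose F (p : T * R) : R := normal_pdf 0 t p.2 *
  (expR (dot (a + p.2 *: x) (Xi p.1)) * expR (t ^+ 2 / 2 * energy (Xi p.1) e)).
have F0 p : (0 <= (F p)%:E)%E by rewrite lee_fin !mulr_ge0 ?normal_pdf_ge0 ?expR_ge0.
have mF : measurable_fun setT (EFin \o F).
  apply/measurable_EFinP; apply: measurable_funM.
    by apply: measurableT_comp; first exact: measurable_normal_pdf.
  apply: measurable_funM; apply: measurableT_comp => //.
    under eq_fun do rewrite dotDl dotZl.
    apply: measurable_funD; last apply: measurable_funM => //.
      exact: (measurableT_comp (measurable_dot_noise _)).
    exact: (measurableT_comp (measurable_dot_noise _)).
  apply: measurable_funM => //.
  exact: (measurableT_comp (measurable_energy _)).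
transitivity (\int[P]_w \int[leb]_l (F (w, l))%:E)%E.
  apply: eq_integral => w _; rewrite /F /=.
  pose C := expR (dot a (Xi w)) * expR (t ^+ 2 / 2 * energy (Xi w) e).
  transitivity (\int[leb]_l (C%:E * ((normal_pdf 0 t l)%:E *
      (expR (dot x (Xi w) * l))%:E)))%E.
    rewrite ge0_integralZl //; first last.
    - by rewrite lee_fin mulr_ge0 ?expR_ge0.
    - by move=> l _; rewrite -EFinM lee_fin mulr_ge0 ?expR_ge0 ?normal_pdf_ge0.
    - apply: emeasurable_funM; apply/measurable_EFinP.
        exact: measurable_normal_pdf.
      by apply: measurableT_comp => //; exact: measurable_funM.
    rewrite gauss_mgf // -EFinM; congr _%:E.
    by rewrite [energy _ _]big_cons -/(energy _ e) mulrDr expRD /C; ring.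
  apply: eq_integral => l _; rewrite -!EFinM; congr _%:E.
  by rewrite dotDl dotZl expRD (mulrC l) /C; ring.
rewrite (@fubini_tonelli _ _ _ _ _ P leb _ mF F0) /=.
transitivity (\int[leb]_l (((r / t) ^+ size e * expR (s ^+ 2 / 2 * dot a a))%:E
   * ((normal_pdf 0 t l)%:E * (expR (s ^+ 2 / 2 * l ^+ 2))%:E)))%E.
  apply: eq_integral => l _; rewrite /F /=.
  transitivity ((normal_pdf 0 t l)%:E *
      \int[P]_w (expR (dot (a + l *: x) (Xi w)) *
                 expR (t ^+ 2 / 2 * energy (Xi w) e))%:E)%E.
    rewrite -ge0_integralZl //.
    - apply/measurable_EFinP; apply: measurable_funM.
        by apply: measurableT_comp => //; exact: measurable_dot_noise.
      apply: measurableT_comp => //; apply: measurable_funM => //.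
      exact: measurable_energy.
    - by rewrite lee_fin normal_pdf_ge0.
  rewrite IH //; last first.
    by move=> z ze; rewrite dotDl dotZl xe // mulr0 addr0 ae // inE ze orbT.
  rewrite -!EFinM; congr _%:E.
  rewrite !(dotDl, dotDr, dotZl, dotZr) (dotC x a) ax x1.
  by rewrite !(mulr0, addr0, add0r, mulr1) mulrDr expRD expr2; ring.
rewrite ge0_integralZl //; first last.
- by rewrite lee_fin mulr_ge0 ?expR_ge0 // exprn_ge0 // divr_ge0 ?ltW.
- by move=> l _; rewrite -EFinM lee_fin mulr_ge0 ?expR_ge0 ?normal_pdf_ge0.
- apply: emeasurable_funM; apply/measurable_EFinP.
    exact: measurable_normal_pdf.
  apply: measurableT_comp => //; exact: measurable_funM.
rewrite (gauss_exp_sqr t0 r0 trs) -EFinM; congr _%:E.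
by rewrite mulrC mulrA -exprS.
Qed.
End Noise.

(** * Normalization of the prior and size of the penalty *)
Section Prior.
Context {R : realType}.

Lemma expR1_ge2 : 2 <= expR 1 :> R.
Proof. by apply: le_trans (expR_ge1Dx _); rewrite -natr1. Qed.

Lemma geometric_le (x b : R) n : 0 <= x -> x < 1 -> 1 <= b * (1 - x) ->
  \sum_(i < n) x ^+ i <= b.
Proof.
move=> x0 x1 bx; have h : 0 < 1 - x by rewrite subr_gt0.
rewrite -(ler_pM2r h); apply: le_trans bx.
rewrite mulrC -opprB mulNr -subrX1 opprB lerBlDr lerDl.
exact: exprn_ge0.
Qed.

Variable n : nat.
Hypothesis n0 : (0 < n)%N.

Lemma Hsum_le2 : @Hsum R n <= 2.
Proof.
have := expR1_ge2 => e2; have e0 := expR_gt0 (1 : R).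
have V0 : 0 <= (expR 1)^-1 :> R by rewrite invr_ge0 ltW.
have V2 : (expR 1)^-1 <= 2^-1 :> R by rewrite lef_pV2 ?posrE.
have -> : @Hsum R n = \sum_(i < n) (expR 1)^-1 ^+ i.
  by apply: eq_bigr => i _; rewrite -expRN -expRM_natl mulrN mulr1.
by apply: geometric_le => //; lra.
Qed.

(** The binomial coefficient in the prior is the number of sets of the given
    cardinality. *)
Lemma sum_prior (f : nat -> R) :
  \sum_(K : {set 'I_n.-1}) prior K * f #|K| =
  \sum_(j < n) expR (- j%:R) * f j / @Hsum R n.
Proof.
have card_lt (K : {set 'I_n.-1}) : (#|K| < n)%N.
  by rewrite -[X in (_ < X)%N](prednK n0) ltnS -[X in (_ <= X)%N](card_ord n.-1) max_card.
rewrite (partition_big (fun K => Ordinal (card_lt K)) xpredT) //=.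
apply: eq_bigr => j _.
have jn : (j <= n.-1)%N by rewrite -ltnS prednK.
have c0 : 'C(n.-1, j)%:R != 0 :> R by rewrite pnatr_eq0 -lt0n bin_gt0.
have H0 : @Hsum R n != 0 by rewrite gt_eqF // Hsum_gt0.
transitivity (\sum_(K | Ordinal (card_lt K) == j)
    expR (- j%:R) / (@Hsum R n * 'C(n.-1, j)%:R) * f j).
  by apply: eq_bigr => K /eqP <-.
rewrite sumr_const -mulr_natl.
have -> : #|[pred K | Ordinal (card_lt K) == j]| = 'C(n.-1, j).
  rewrite -[in RHS](card_ord n.-1) -card_draws; apply: eq_card => K.
  by rewrite !inE -val_eqE.
by field; rewrite H0 c0.
Qed.

(** A geometric series of ratio at most [23 / 20 / expR 1 <= 23 / 40]. *)
Lemma sum_prior_pow (C : R) : 0 <= C -> C <= 23 / 20 ->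
  \sum_(K : {set 'I_n.-1}) prior K * C ^+ #|K| <= 3.
Proof.
move=> C0 C1; rewrite sum_prior -mulr_suml ler_pdivrMr ?Hsum_gt0 //.
apply: le_trans (_ : 3 <= _); last by rewrite ler_peMr // Hsum_ge1.
have := expR1_ge2 => e2; have e0 := expR_gt0 (1 : R).
have V0 : 0 <= (expR 1)^-1 :> R by rewrite invr_ge0 ltW.
have V2 : (expR 1)^-1 <= 2^-1 :> R by rewrite lef_pV2 ?posrE.
under eq_bigr => i _.
  rewrite -[i%:R]mulr1 -mulrN expRM_natl expRN -exprMn.
  over.
have x0 : 0 <= (expR 1)^-1 * C by rewrite mulr_ge0.
have x1 : (expR 1)^-1 * C <= 2^-1 * (23 / 20) by rewrite ler_pM.
by apply: geometric_le => //; lra.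
Qed.

(** With [x = k / n] at most one, the binomial coefficient times [x ^+ k] is at
    most a term of the expansion of [(1 + x) ^+ n.-1], and this power is at most
    [expR x ^+ n = expR k]. *)
Lemma ln_bin_le (k j : nat) : (0 < k <= n)%N -> (j < k)%N -> (j <= n.-1)%N ->
  ln ('C(n.-1, j)%:R) <= k%:R * ln (expR 1 * n%:R / k%:R) :> R.
Proof.
move=> /andP[k0 kn] jk jn.
have k0R : 0 < k%:R :> R by rewrite ltr0n.
have n0R : 0 < n%:R :> R by rewrite ltr0n.
pose x : R := k%:R / n%:R.
have x0 : 0 < x by rewrite divr_gt0.
have x1 : x <= 1 by rewrite ler_pdivrMr // mul1r ler_nat.
have c0 : 0 < 'C(n.-1, j)%:R :> R by rewrite ltr0n bin_gt0.
have H : 'C(n.-1, j)%:R * x ^+ k <= expR k%:R.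
  apply: le_trans (_ : (1 + x) ^+ n.-1 <= _).
    rewrite addrC exprD1n (bigD1 (Ordinal (jn : (j < n.-1.+1)%N))) //=.
    apply: le_trans (_ : 'C(n.-1, j)%:R * x ^+ j <= _).
      apply: ler_wpM2l => //; apply: ler_wiXn2l => //; first exact: ltW.
      exact: ltnW.
    rewrite mulr_natl lerDl; apply: sumr_ge0 => i _.
    by rewrite mulrn_wge0 // exprn_ge0 // ltW.
  apply: le_trans (_ : (1 + x) ^+ n <= _).
    by rewrite ler_weXn2l ?leq_pred // lerDl ltW.
  have -> : expR k%:R = expR x ^+ n.
    by rewrite -expRM_natl mulrC /x divfK ?gt_eqF.
  by rewrite lerXn2r ?nnegrE ?expR_ge0 ?expR_ge1Dx // addr_ge0 // ltW.
have -> : k%:R * ln (expR 1 * n%:R / k%:R) = ln (expR k%:R * x ^- k) :> R.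
  rewrite mulr_natl -lnXn ?divr_gt0 ?mulr_gt0 ?expR_gt0 //; congr ln.
  rewrite -mulrA exprMn -exprVn invf_div; congr (_ * _).
  by rewrite -expRM_natl mulr1.
rewrite ler_ln ?posrE ?mulr_gt0 ?expR_gt0 ?invr_gt0 ?exprn_gt0 //.
by rewrite ler_pdivlMr // exprn_gt0.
Qed.

Lemma rate_ge1 k : (0 < k <= n)%N ->
  1 <= ln (expR 1 * n%:R / k%:R) :> R.
Proof.
move=> /andP[k0 kn].
have k0R : 0 < k%:R :> R by rewrite ltr0n.
have n0R : 0 < n%:R :> R by rewrite ltr0n.
rewrite -[X in X <= _](expRK 1) ler_ln ?posrE ?divr_gt0 ?mulr_gt0 ?expR_gt0 //.
by rewrite ler_pdivlMr // ler_wpM2l ?expR_ge0 // ler_nat.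
Qed.

Lemma penalty_le (sigma : R) k (J : {set 'I_n.-1}) :
  (0 < k <= n)%N -> (#|J| < k)%N ->
  penalty sigma J <=
    186 * (sigma ^+ 2 * k%:R * ln (expR 1 * n%:R / k%:R)).
Proof.
move=> kn Jk; have l1 := rate_ge1 kn.
have /andP[k0 _] := kn; set l := ln _ in l1 *.
have k1 : 1 <= k%:R :> R by rewrite ler1n.
have Jk' : #|J|%:R <= k%:R :> R by rewrite ler_nat ltnW.
have Jn : (#|J| <= n.-1)%N by rewrite -[X in (_ <= X)%N](card_ord n.-1) max_card.
have lnb := ln_bin_le kn Jk Jn; rewrite -/l in lnb.
have H0 := @Hsum_gt0 R n n0; have H2 := Hsum_le2.
have lnH : ln (@Hsum R n) <= 2.
  rewrite -[X in ln X](subrK 1) addrC; apply: le_trans (le_ln1Dx _) _; lra.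
have c0 : 0 < 'C(n.-1, #|J|)%:R :> R by rewrite ltr0n bin_gt0.
have lnE : ln (1 / @prior R n J) = #|J|%:R + ln (@Hsum R n) + ln 'C(n.-1, #|J|)%:R.
  rewrite div1r lnV ?posrE ?prior_gt0 // /prior ln_div ?posrE ?expR_gt0 ?mulr_gt0 //.
  by rewrite expRK lnM ?posrE // opprB opprK addrC addrA.
have kl : k%:R <= k%:R * l by rewrite ler_peMr // ler0n.
have ln4 : ln (1 / @prior R n J) <= 4 * (k%:R * l) by rewrite lnE; lra.
have : 0 <= sigma ^+ 2 by exact: sqr_ge0.
rewrite /penalty; move: (sigma ^+ 2) => s2 s20; rewrite -!mulrA.
apply: le_trans (_ : 2 * (s2 * (k%:R * l)) +
   46 * (s2 * (4 * (k%:R * l))) <= _); last lra.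
by apply: lerD; apply: ler_wpM2l => //; apply: ler_wpM2l => //; lra.
Qed.

End Prior.

(** * Risk bounds *)
Section Affine.
Context {d : measure_display} {T : measurableType d} {R : realType}.
Variable P : probability T R.

Lemma integral_affine (I : finType) (c : R) (b M : I -> R) (X : I -> T -> R) :
  0 <= c -> (forall i, 0 <= b i) -> (forall i w, 0 <= X i w) ->
  (forall i, measurable_fun setT (X i)) ->
  (forall i, (\int[P]_w (X i w)%:E = (M i)%:E)%E) ->
  (\int[P]_w (c + \sum_i b i * X i w)%:E = (c + \sum_i b i * M i)%:E)%E.
Proof.
move=> c0 b0 X0 mX XM; under eq_integral do rewrite EFinD -sumEFin.
rewrite ge0_integralD //; first last.
- apply/emeasurable_sum => i; apply/measurable_EFinP.
  exact: measurable_funM.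
- by move=> w _; apply: sume_ge0 => i _; rewrite lee_fin mulr_ge0.
have -> : (\int[P]_w c%:E = c%:E)%E.
  by have := expectation_cst P c; rewrite unlock.
rewrite ge0_integral_sum //; first last.
- by move=> i w _; rewrite lee_fin mulr_ge0.
- by move=> i; apply/measurable_EFinP; exact: measurable_funM.
rewrite EFinD -sumEFin; congr (_ + _)%E; apply: eq_bigr => i _.
under eq_integral do rewrite EFinM.
rewrite ge0_integralZl ?XM //; last by rewrite lee_fin.
  exact/measurable_EFinP.
by move=> w _; rewrite lee_fin.
Qed.

Lemma integral_affine_le (c b M : R) (D : T -> R) :
  0 <= c -> 0 <= b -> (forall w, 0 <= D w) -> measurable_fun setT D ->
  (\int[P]_w (D w)%:E <= M%:E)%E ->
  (\int[P]_w (c + b * D w)%:E <= (c + b * M)%:E)%E.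
Proof.
move=> c0 b0 D0 mD DM; under eq_integral do rewrite EFinD EFinM.
rewrite ge0_integralD //; first last.
- by apply/measurable_EFinP; exact: measurable_funM.
- by move=> w _; rewrite -EFinM lee_fin mulr_ge0.
have -> : (\int[P]_w c%:E = c%:E)%E.
  by have := expectation_cst P c; rewrite unlock.
rewrite ge0_integralZl //; first last.
- by move=> w _; rewrite lee_fin.
- exact/measurable_EFinP.
by rewrite EFinD EFinM leeD2l // lee_wpmul2l.
Qed.

End Affine.

Section ExcessRisk.
Context {d : measure_display} {T : measurableType d} {R : realType}.
Context (P : probability T R) (n k : nat) (sigma : R).
Context (xi : 'I_n -> {RV P >-> R}).
Hypothesis sigma0 : 0 < sigma.
Hypothesis kn : (0 < k <= n)%N.
Hypothesis noise : gaussian_noise sigma xi.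

Let rate : R := sigma ^+ 2 * k%:R / n%:R * ln (expR 1 * n%:R / k%:R).

(** [energy_mgf] with [t ^+ 2 = 3 / (23 sigma ^+ 2)], so that
    [t ^+ 2 / 2 = 3 / (46 sigma ^+ 2)], and
    [r ^+ 2 = 3 / (20 sigma ^+ 2)]; each dimension then costs the factor
    [r / t], the square root of [23 / 20]. *)
Lemma energy_moment (e : seq 'cV[R]_n) : orthonormal e -> exists M : R,
  [/\ (\int[P]_w (expR (3 / (46 * sigma ^+ 2) *
          energy (\col_i xi i w) e))%:E = M%:E)%E &
      M <= (23 / 20) ^+ size e].
Proof.
move=> oe; pose t := Num.sqrt (3 / 23) / sigma; pose r := Num.sqrt (3 / 20) / sigma.
have t0 : 0 < t by rewrite divr_gt0 // sqrtr_gt0 divr_gt0.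
have r0 : 0 < r by rewrite divr_gt0 // sqrtr_gt0 divr_gt0.
have t2 : t ^+ 2 = 3 / 23 / sigma ^+ 2.
  by rewrite exprMn exprVn sqr_sqrtr // divr_ge0.
have r2 : r ^+ 2 = 3 / 20 / sigma ^+ 2.
  by rewrite exprMn exprVn sqr_sqrtr // divr_ge0.
have tr : t ^- 2 = r ^- 2 + sigma ^+ 2.
  by rewrite t2 r2; field; rewrite gt_eqF.
have := @energy_mgf _ _ _ _ _ _ _ sigma0 noise t r e t0 r0 tr oe 0.
move=> /(_ (fun x _ => dot0l x)) H; exists ((r / t) ^+ size e); split.
  have -> : 3 / (46 * sigma ^+ 2) = t ^+ 2 / 2.
    by rewrite t2; field; rewrite gt_eqF.
  rewrite dot0l mulr0 expR0 mulr1 in H; rewrite -H; apply: eq_integral => w _.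
  by rewrite dot0l expR0 mul1r.
have rt0 : 0 <= r / t by rewrite ltW // divr_gt0.
have tc0 : 0 <= 23 / 20 * t by rewrite ltW // mulr_gt0 // divr_gt0.
apply: lerXn2r; first exact: rt0.
  by rewrite nnegrE divr_ge0.
rewrite ler_pdivrMr // -(@ler_pXn2r _ 2) ?nnegrE ?(ltW r0) //.
rewrite [leRHS]exprMn t2 r2 mulrA ler_pM2r ?invr_gt0 ?exprn_gt0 //.
by rewrite expr2; lra.
Qed.

(** The level [m] of [Q_oracle_exp] is [#|J| + 1], for which [expR (- m)] cancels
    the part of the exponential moments due to the dimension of [VJ J]. The
    constant 370 is the sum of 186, from [penalty_le], and of 46 times 4, as
    [m] is at most [k] and the prior average times [expR (- m)] at most 3. *)
Lemma risk_domination (mu u : 'cV[R]_n) : monok k u ->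
  exists D : T -> R, [/\ forall w, 0 <= D w, measurable_fun setT D,
    (\int[P]_w (D w)%:E <= (370 * rate)%:E)%E &
    forall w th, is_Q_weights sigma (observation mu xi w) th ->
      snorm (mu_of th (observation mu xi w) - mu) ^+ 2 <=
      snorm (u - mu) ^+ 2 + D w].
Proof.
move=> [_ /= uk]; have /andP[k0 kn'] := kn.
have n0 : (0 < n)%N by exact: leq_trans k0 kn'.
have n0R : 0 < n%:R :> R by rewrite ltr0n.
pose J := [set i : 'I_n.-1 | u (gapr i) 0 != u (gapl i) 0]%SET.
have Jk : (#|J| < k)%N by exact: uk.
have uJ : VJ J u by move=> i; rewrite inE negbK => /eqP.
have [e he] := choice (fun K => @VJ_orthonormal_basis R n (K :|: J)).
have espan K v : VJ (K :|: J) v -> spans (e K) v by have [_ _] := he K; apply.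
pose X K w := expR (3 / (46 * sigma ^+ 2) * energy (\col_i xi i w) (e K)).
have oe K : orthonormal (e K) by have [] := he K.
have [M hM] := choice (fun K => energy_moment (oe K)).
pose m : R := #|J|.+1%:R.
pose beta := 46 * sigma ^+ 2.
have beta0 : 0 < beta by rewrite mulr_gt0 // exprn_gt0.
pose c := n%:R^-1 * (penalty sigma J + beta * m).
pose b (K : {set 'I_n.-1}) := n%:R^-1 * (beta * expR (- m)) * prior K.
pose D w := c + \sum_K b K * X K w.
have DE w : D w = n%:R^-1 * (penalty sigma J + beta * (m + expR (- m) *
    \sum_K prior K * X K w)).
  rewrite /D /c /b; under eq_bigr do rewrite -mulrA.
  by rewrite -mulr_sumr; ring.
have pen0 : 0 <= penalty sigma J.
  rewrite addr_ge0 // mulr_ge0 // ?(ltW beta0) //; last first.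
    rewrite ln_ge0 // div1r -invr1 lef_pV2 ?posrE ?prior_gt0 //.
    rewrite ler_pdivrMr ?mulr_gt0 ?Hsum_gt0 ?ltr0n ?card_bin_gt0 // mul1r.
    apply: le_trans (_ : 1 <= _); first by rewrite -expR0 ler_expR oppr_le0.
    by apply: mulr_ege1; rewrite ?Hsum_ge1 // ler1n card_bin_gt0.
  by rewrite mulr_ge0 // sqr_ge0.
have c0 : 0 <= c.
  by rewrite mulr_ge0 ?invr_ge0 // addr_ge0 // mulr_ge0 // ltW.
have b0 K : 0 <= b K.
  rewrite ltW // mulr_gt0 ?prior_gt0 // mulr_gt0 ?invr_gt0 //.
  by rewrite mulr_gt0 ?expR_gt0.
have X0 K w : 0 <= X K w by exact: expR_ge0.
have mX K : measurable_fun setT (X K).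
  apply: measurableT_comp => //; apply: measurable_funM => //.
  exact: measurable_energy.
exists D; split.
- by move=> w; rewrite addr_ge0 // sumr_ge0 // => K _; rewrite mulr_ge0.
- apply: measurable_funD => //; apply: measurable_sum => K.
  exact: measurable_funM.
- rewrite (@integral_affine _ _ _ P _ c b M X) // => [|K]; last by have [] := hM K.
  rewrite lee_fin.
  have l1 := @rate_ge1 R n n0 k kn.
  have pen := penalty_le n0 sigma kn Jk.
  have S3 := @sum_prior_pow R n n0 (23 / 20) _ (lexx _).
  have mk : m <= k%:R by rewrite ler_nat.
  have k1 : 1 <= k%:R :> R by rewrite ler1n.
  have mom : expR (- m) * \sum_K prior K * M K <= 3.
    apply: le_trans (S3 _); last by rewrite divr_ge0.
    rewrite mulr_sumr; apply: ler_sum => K _; rewrite mulrCA.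
    rewrite ler_wpM2l ?(ltW (prior_gt0 _ n0)) //.
    have [_ MK] := hM K; have [eK _ _] := he K.
    have C1 : 1 <= 23 / 20 :> R by lra.
    apply: le_trans (_ : expR (- m) * (23 / 20) ^+ (#|J|.+1 + #|K|) <= _).
      rewrite ler_wpM2l ?expR_ge0 // (le_trans MK) // ler_weXn2l //.
      rewrite (leq_trans eK) // addSn ltnS addnC.
      by rewrite (leq_trans (leq_card_setU _ _)).
    rewrite exprD mulrA ler_piMl ?exprn_ge0 ?divr_ge0 //.
    rewrite expRN mulrC ler_pdivrMr ?expR_gt0 // mul1r.
    have -> : expR m = expR 1 ^+ #|J|.+1 by rewrite -expRM_natl mulr1.
    rewrite lerXn2r ?nnegrE ?divr_ge0 ?expR_ge0 //.
    by have := @expR1_ge2 R; lra.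
  have -> : c + \sum_K b K * M K = n%:R^-1 * (penalty sigma J + beta *
      (m + expR (- m) * \sum_K prior K * M K)).
    rewrite /c /b; under eq_bigr do rewrite -mulrA.
    by rewrite -mulr_sumr; ring.
  rewrite /rate; set l := ln _ in l1 pen *.
  have kl : k%:R <= k%:R * l by rewrite ler_peMr // ler0n.
  have -> : 370 * (sigma ^+ 2 * k%:R / n%:R * l) =
      n%:R^-1 * (186 * (sigma ^+ 2 * k%:R * l) + beta * (4 * (k%:R * l))).
    by rewrite /beta; field; rewrite gt_eqF.
  rewrite ler_wpM2l ?invr_ge0 // lerD // ler_wpM2l ?(ltW beta0) //; lra.
- move=> w th Q; rewrite !snorm_sqr DE -mulrDr ler_wpM2l ?invr_ge0 //.
  have := @Q_oracle_exp R n sigma mu _ th J e m n0 sigma0 Q espan.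
  move=> /le_trans; apply; rewrite -addrA; apply: lerD => //.
  exact: PJ_best.
Qed.

End ExcessRisk.

Theorem mainTheorem4 (R : realType) :
  exists c : R, 0 < c /\
  forall (n : nat) (sigma : R) (k : nat)
    (d : measure_display) (T : measurableType d) (P : probability T R)
    (xi : 'I_n -> {RV P >-> R})
    (thetahat : 'cV[R]_n -> ({set 'I_n.-1} -> R)),
  (2 <= n)%N -> 0 < sigma -> (1 <= k <= n)%N ->
  gaussian_noise sigma xi ->
  (forall y : 'cV[R]_n, is_Q_weights sigma y (thetahat y)) ->
  let muQ := fun y : 'cV[R]_n => mu_of (thetahat y) y in
  (ereal_sup [set ('E_P[fun w => snorm (muQ (observation mu xi w) - mu)]
                   - (inf [set snorm (u - mu) | u in monok k])%:E)%E
              | mu in [set: 'cV[R]_n]]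
   <= (c * Num.sqrt (sigma ^+ 2 * k%:R / n%:R
                     * ln (expR 1 * n%:R / k%:R)))%:E)%E
  /\
  (ereal_sup [set ('E_P[fun w => (snorm (muQ (observation mu xi w) - mu) ^+ 2)%R]
                   - (inf [set (snorm (u - mu) ^+ 2)%R | u in monok k])%:E)%E
              | mu in [set: 'cV[R]_n]]
   <= (c * sigma ^+ 2 * k%:R / n%:R * ln (expR 1 * n%:R / k%:R))%:E)%E.
Proof.
have [c c1 cE] : exists2 c : R, 1 <= c & c = 370.
  by exists 370; rewrite ?ler1n.
have c0 : 0 < c by exact: lt_le_trans ltr01 c1.
exists c; split=> // n sigma k d T P xi thetahat n2 s0 kn noise Q muQ.
have /andP[k0 kn'] := kn.
have n0 : (0 < n)%N by exact: leq_trans k0 kn'.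
set rate := _ * ln _; rewrite -/rate.
have -> : c * sigma ^+ 2 * k%:R / n%:R * ln (expR 1 * n%:R / k%:R) = c * rate.
  by rewrite /rate !mulrA.
have rate0 : 0 < rate.
  have l0 := lt_le_trans ltr01 (@rate_ge1 R n n0 k kn).
  by rewrite !mulr_gt0 ?invr_gt0 ?ltr0n ?exprn_gt0.
pose q := c * rate; pose rho := Num.sqrt q.
have q0 : 0 < q by rewrite mulr_gt0.
have rho0 : 0 < rho by rewrite sqrtr_gt0.
have rho2 : rho ^+ 2 = q by rewrite sqr_sqrtr // ltW.
split; apply: ge_ereal_sup => _ [mu _ <-].
all: have [u uk [infE infE2]] := inf_monok_min mu k0.
all: have [D [D0 mD ID DQ]] := risk_domination s0 kn noise mu uk.
all: rewrite -cE in ID.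
all: rewrite ?infE ?infE2 leeBlDr // unlock.
- set a := snorm (u - mu).
  have a0 : 0 <= a by exact: sqrtr_ge0.
  have pointwise w : snorm (muQ (observation mu xi w) - mu) <=
      a + rho / 2 + (2 * rho)^-1 * D w.
    (* The square of [y] exceeds [D w] by the square of [z], which is the
       inequality between arithmetic and geometric means. *)
    pose y := rho / 2 + (2 * rho)^-1 * D w.
    pose z := rho / 2 - (2 * rho)^-1 * D w.
    have y0 : 0 <= y.
      by rewrite addr_ge0 ?divr_ge0 ?(ltW rho0) // mulr_ge0 // invr_ge0 ltW // mulr_gt0.
    have yE : y ^+ 2 = D w + z ^+ 2 by rewrite /y /z; field; rewrite gt_eqF.
    have ay0 : 0 <= a + y by rewrite addr_ge0.
    rewrite -addrA -(@ler_pXn2r _ 2) ?nnegrE ?sqrtr_ge0 //.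
    apply: le_trans (DQ w _ (Q _)) _; rewrite -/a -/y sqrrD yE -subr_ge0.
    have -> : a ^+ 2 + a * y *+ 2 + (D w + z ^+ 2) - (a ^+ 2 + D w) =
      a * y *+ 2 + z ^+ 2 by ring.
    by rewrite addr_ge0 ?sqr_ge0 // mulrn_wge0 // mulr_ge0.
  have := @ge0_integral_mono _ _ _ P
    (fun w => (snorm (muQ (observation mu xi w) - mu))%:E)
    (fun w => (a + rho / 2 + (2 * rho)^-1 * D w)%:E).
  move=> /(_ (fun w => sqrtr_ge0 _)) /(_ pointwise) /le_trans; apply.
  apply: le_trans (integral_affine_le _ _ D0 mD ID) _.
  + by rewrite addr_ge0 // divr_ge0 // ltW.
  + by rewrite invr_ge0 ltW // mulr_gt0.
  rewrite -EFinD lee_fin -/q -rho2.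
  have -> : a + rho / 2 + (2 * rho)^-1 * rho ^+ 2 = rho + a.
    by field; rewrite gt_eqF.
  rewrite lerD2r /rho /q sqrtrM ?(ltW c0) // ler_wpM2r ?sqrtr_ge0 //.
  rewrite -[leRHS]ger0_norm ?(ltW c0) // -sqrtr_sqr ler_wsqrtr // expr2.
  by rewrite ler_peMl // ltW.
- have := @ge0_integral_mono _ _ _ P
    (fun w => (snorm (muQ (observation mu xi w) - mu) ^+ 2)%:E)
    (fun w => (snorm (u - mu) ^+ 2 + 1 * D w)%:E).
  move=> /(_ (fun w => sqr_ge0 _)) H; apply: le_trans (H _) _.
    by move=> w; rewrite lee_fin mul1r; exact: DQ.
  apply: le_trans (integral_affine_le _ _ D0 mD ID) _ => //; first exact: sqr_ge0.
  by rewrite mul1r addrC.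
Qed.
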